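(* Suppose that the Rankine-Hugoniot relation $f(u_\ell)=f(u_r)$ and the entropy inequalities $f'(u_r)<0<f'(u_\ell)$ hold. Then under the condition $\max(\alpha_\ell,|\alpha_r|)<1$, the function $\underline{\Delta}$ given in the context is well defined and holomorphic on a neighborhood of $\{\zeta\in\mathbb{C}: |\zeta|\ge1\}$, and $1$ is an eigenvalue of $\mathscr{L}$ in $\ell^q(\mathbb{Z};\mathbb{C})$ for any $q\in[1,+\infty]$. Moreover, if $\underline{\Delta}'(1)\neq0$ and $\underline{\Delta}$ does not vanish on $\{\zeta\in\mathbb{C}:|\zeta|\ge1\}\setminus\{1\}$, then the operator $\mathscr{L}$ has no spectrum in $\{\zeta\in\mathbb{C}:|\zeta|\ge1\}\setminus\{1\}$.
   Context: Let $f\in\mathscr{C}^\infty(\mathbb{R};\mathbb{R})$ and consider the scalar conservation law $\partial_t u+\partial_x f(u)=0$, $x\in\mathbb{R}$. Let $u_\ell,u_r\in\mathbb{R}$ and consider the step function $u(t,x)=u_\ell$ for $x<0$, $u(t,x)=u_r$ for $x>0$ (a weak solution when $f(u_\ell)=f(u_r)$). Let $\lambda>0$ and set $\alpha_\ell:=\lambda f'(u_\ell)$, $\alpha_r:=\lambda f'(u_r)$, $\alpha_m:=\lambda f'\big(\frac{u_\ell+u_r}{2}\big)$. The bounded linear operator $\mathscr{L}$ on $\ell^q(\mathbb{Z};\mathbb{C})$, $1\le q\le+\infty$ (linearized Lax-Wendroff scheme), is defined by $$(\mathscr{L}\mathbf{w})_j:=\begin{cases} w_j-\frac{\alpha_r}{2}(w_{j+1}-w_{j-1})+\frac{\alpha_r^2}{2}(w_{j+1}-2w_j+w_{j-1}),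 & j\ge2,\\ w_j-\frac{\alpha_\ell}{2}(w_{j+1}-w_{j-1})+\frac{\alpha_\ell^2}{2}(w_{j+1}-2w_j+w_{j-1}), & j\le-1,\\ w_0-\frac12(\alpha_r w_1-\alpha_\ell w_{-1})+\frac12\big(\alpha_r\alpha_m w_1-\alpha_\ell(\alpha_\ell+\alpha_m)w_0+\alpha_\ell^2 w_{-1}\big), & j=0,\\ w_1-\frac12(\alpha_r w_2-\alpha_\ell w_0)+\frac12\big(\alpha_r^2 w_2-\alpha_r(\alpha_r+\alpha_m)w_1+\alpha_\ell\alpha_m w_0\big), & j=1.\end{cases}$$ The spectrum is understood for $\mathscr{L}$ acting on $\ell^q(\mathbb{Z};\mathbb{C})$, for any $q\in[1,+\infty]$. Lopatinskii determinant. For $z\in\mathbb{C}$ with $|z|>\max(\sqrt{1-\alpha_\ell^2},\sqrt{1-\alpha_r^2})$, let $\kappa_\ell(z)$ denote the root of largest modulus of $\frac{\alpha_\ell(\alpha_\ell-1)}{2}\kappa^2+(1-\alpha_\ell^2-z)\kappa+\frac{\alpha_\ell(\alpha_\ell+1)}{2}=0$, and let $\kappa_r(z)$ denote the root of smallest modulus of $\frac{\alpha_r(\alpha_r-1)}{2}\kappa^2+(1-\alpha_r^2-z)\kappa+\frac{\alpha_r(\alpha_r+1)}{2}=0$ (in each case the two roots have distinct moduli and are nonzero). Define $$\underline{\Delta}(z):=1-\alpha_m^2+\big(\alpha_\ell-\alpha_m+(1-\alpha_\ell)\kappa_\ell(z)\big)\Big(\alpha_r-\alpha_m-\frac{1+\alpha_r}{\kappa_r(z)}\Big).$$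 *)

(* Defs.v *)
From HB Require Import structures.
From mathcomp Require Import all_boot all_order all_algebra.
From mathcomp Require Import all_classical all_reals all_analysis.
From mathcomp Require Import complex.

Set Implicit Arguments.
Unset Strict Implicit.
Unset Printing Implicit Defensive.

Import Order.TTheory GRing.Theory Num.Theory.
Import numFieldNormedType.Exports.
Import ComplexField.Normc.

Local Open Scope classical_set_scope.
Local Open Scope ring_scope.
Local Open Scope complex_scope.

HB.instance Definition _ := isPointed.Build int 0.

HB.instance Definition _ := @isMeasurable.Build default_measure_display
  int discrete_measurable discrete_measurable0
  discrete_measurableC discrete_measurableU.

Definition smooth (R : realType) (f : R -> R) : Prop :=
  forall (n : nat) (x : R), derivable (derive1n n f) x 1.

(* [R[i]^o] is R[i] seen as a normed module over itself, so that derivability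
   in the direction 1 is complex differentiability. *)
Definition holomorphic_on (R : realType) (U : set R[i]^o)
    (F : R[i]^o -> R[i]^o) : Prop :=
  open U /\ forall z, U z -> derivable F z 1.

Section sequence_spaces.
Variable R : realType.
Implicit Types (q : \bar R) (u v w : int -> R[i]) (z : R[i]).
Implicit Types T S : (int -> R[i]) -> int -> R[i].

Definition lq_norm q w : \bar R :=
  Lnorm (@counting int R) q (fun j => (normc (w j))%:E).

Definition lq q : set (int -> R[i]) := [set w | (lq_norm q w < +oo)%E].

(* Operators are total functions on all sequences; only their action on l^q is
   relevant. The norm bound forces T to map l^q to l^q. *)
Definition bounded_linear_on_lq q T : Prop :=
  (forall (c : R[i]) u v, lq q u -> lq q v ->
     T (c \*o u \+ v) = c \*o T u \+ T v) /\
  (exists M : R, forall w, lq q w -> (lq_norm q (T w) <= M%:E * lq_norm q w)%E).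

(* Intended for T bounded on l^q: z is in the resolvent set when z - T has a
   two-sided bounded inverse S on l^q. *)
Definition resolvent_set q T : set R[i] :=
  [set z | exists S, bounded_linear_on_lq q S /\
     forall w, lq q w -> S (z \*o w \- T w) = w /\ z \*o S w \- T (S w) = w].

Definition spectrum q T : set R[i] := ~` resolvent_set q T.

Definition is_eigenvalue q T z : Prop :=
  exists w, [/\ lq q w, w <> (fun=> 0) & T w = z \*o w].

End sequence_spaces.

Section lax_wendroff.
Variable R : realType.
Implicit Types (a al ar am : R) (w : int -> R[i]) (k z : R[i]).

Definition lax_wendroff_interior a w (j : int) : R[i] :=
  w j - a%:C / 2 * (w (j + 1) - w (j - 1))
      + a%:C ^+ 2 / 2 * (w (j + 1) - 2 * w j + w (j - 1)).

Definition lax_wendroff al ar am w (j : int) : R[i] :=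
  if 2 <= j then lax_wendroff_interior ar w j
  else if j <= -1 then lax_wendroff_interior al w j
  else if j == 0 then
    w 0 - 2^-1 * (ar%:C * w 1 - al%:C * w (-1))
        + 2^-1 * (ar%:C * am%:C * w 1 - al%:C * (al%:C + am%:C) * w 0
                  + al%:C ^+ 2 * w (-1))
  else
    w 1 - 2^-1 * (ar%:C * w 2 - al%:C * w 0)
        + 2^-1 * (ar%:C ^+ 2 * w 2 - ar%:C * (ar%:C + am%:C) * w 1
                  + al%:C * am%:C * w 0).

Definition char_eq a z k : Prop :=
  a%:C * (a%:C - 1) / 2 * k ^+ 2 + (1 - a%:C ^+ 2 - z) * k
    + a%:C * (a%:C + 1) / 2 = 0.

Definition char_split a z : Prop :=
  exists k1 k2, (forall k, char_eq a z k <-> k = k1 \/ k = k2) /\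
                0 < normc k1 < normc k2.

(* The root of largest (for kappa_l) or smallest (for kappa_r) modulus:
   [xget 0 A] is a chosen element of A (0 if A is empty); the choice is forced
   when [char_split] holds. *)
Definition kappa_l al z : R[i] :=
  xget 0 [set k | char_eq al z k /\
                  forall k', char_eq al z k' -> normc k' <= normc k].

Definition kappa_r ar z : R[i] :=
  xget 0 [set k | char_eq ar z k /\
                  forall k', char_eq ar z k' -> normc k <= normc k'].

Definition Lopatinskii_domain al ar : set R[i] :=
  [set z | Num.max (Num.sqrt (1 - al ^+ 2)) (Num.sqrt (1 - ar ^+ 2)) < normc z].

Definition Lopatinskii al ar am : R[i]^o -> R[i]^o := fun z =>
  1 - am%:C ^+ 2
  + (al%:C - am%:C + (1 - al%:C) * kappa_l al z)
    * (ar%:C - am%:C - (1 + ar%:C) / kappa_r ar z).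

End lax_wendroff.

(* Main.v *)
(** The scheme has constant coefficients off the two cells j = 0, 1. A root k of
    the characteristic equation with coefficient a and |k|^2 = n
    satisfies, writing m = a(a-1)n/2 + a(a+1)/2,
    a^2 n |z|^2 = (1 - a^2) a^2 n + m^2 - (1 - a^2) (m - a^2 Re k)^2.
    Equal moduli force m = 0, hence |z|^2 <= 1 - a^2; and for a > 0 no root can
    satisfy 1 <= n <= (1+a)/(1-a) when |z| >= 1, except k = z = 1. So, for |z| >= 1
    and z <> 1, exactly one root lies inside the unit disc and one outside.

    Factoring the second order recurrence into two first order ones then gives
    bounded solution operators on the whole line. Gluing the left and right
    solutions leaves an error at j = 0, 1 only, which is removed with the two
    decaying modes: this is a 2 x 2 system of determinant
    (al ar / 4) Lopatinskii(z). At z = 1 the determinant vanishes and a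
    combination of the modes is the eigenvector. *)

Require Import Defs.
From mathcomp Require Import all_boot all_order all_algebra.
From mathcomp Require Import all_classical all_reals all_analysis.
From mathcomp Require Import ess_sup_inf complex.
From mathcomp Require Import ring lra zify.
Set Implicit Arguments.
Unset Strict Implicit.
Unset Printing Implicit Defensive.
Import Order.TTheory GRing.Theory Num.Theory.
Import numFieldNormedType.Exports.
Import ComplexField.Normc.
Local Open Scope classical_set_scope.
Local Open Scope ring_scope.
Local Open Scope complex_scope.

(** * The norm of l^q(Z) *)

Section lq_norm_theory.
Variable R : realType.
Implicit Types (q : \bar R) (u v w : int -> R[i]).

(** An explicit enumeration of Z, even codes for nonnegative integers and odd codes for negative
    ones. It lets sums over [int] be read as series over [nat]. *)
Definition nat_to_int (n : nat) : int := if odd n then Negz n./2 else Posz n./2.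

Definition int_to_nat (j : int) : nat :=
  match j with Posz n => n.*2 | Negz n => n.*2.+1 end.

Lemma nat_to_intK : cancel nat_to_int int_to_nat.
Proof. by move=> n; rewrite /nat_to_int; case: ifP => /= on; lia. Qed.

Lemma int_to_natK : cancel int_to_nat nat_to_int.
Proof.
by case=> n; rewrite /nat_to_int /= odd_double /= ?uphalf_double ?doubleK.
Qed.

Lemma set_bijTT (T T' : choiceType) (e : T -> T') :
  bijective e -> set_bij [set: T] [set: T'] e.
Proof. by rewrite setTT_bijective. Qed.

Lemma esum_nat_to_int (a : int -> \bar R) :
  (\esum_(j in [set: int]) a j = \esum_(n in [set: nat]) a (nat_to_int n))%E.
Proof.
apply: reindex_esum; apply: set_bijTT.
by exists int_to_nat; [exact: nat_to_intK|exact: int_to_natK].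
Qed.

(** As a series of Dirac masses, the counting measure falls under the theorem on integrals against a
    series of measures, so integrals against it become sums. The masses at points outside [A]
    contribute zero, and those inside count its elements. *)
Lemma counting_int (A : set int) :
  counting A = (\sum_(n <oo) \d_(nat_to_int n) A)%E :> \bar R.
Proof.
rewrite nneseries_esumT// -(esum_nat_to_int (fun j => \d_j A)) (esumID A)// !setTI.
rewrite [X in (_ + X)%E](_ : _ = 0%E) ?adde0//; last first.
  by apply: esum1 => i Ai; rewrite /= /dirac indicE memNset.
rewrite /counting/=; case: ifPn => /asboolP finA.
  by rewrite -finite_card_dirac.
by rewrite infinite_card_dirac.
Qed.

Lemma integral_counting_int (a : int -> \bar R) : (forall j, 0 <= a j)%E ->
  (\int[counting]_j a j = \esum_(j in [set: int]) a j)%E.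
Proof.
move=> a0.
transitivity (\int[mseries (fun n => \d_(nat_to_int n)) O]_t a t)%E.
  by congr (integral _ _ _); apply/funext => A; rewrite /= counting_int.
rewrite (@ge0_integral_measure_series _ _ R (fun n => \d_(nat_to_int n)) setT)//=.
under eq_eseriesr do rewrite integral_dirac//= diracT mul1e.
by rewrite nneseries_esumT// -(esum_nat_to_int a).
Qed.

Lemma lq_normE (r : R) w : 1 <= r -> lq_norm r%:E w =
  ((\esum_(j in [set: int]) (normc (w j) `^ r)%:E) `^ r^-1)%E.
Proof.
move=> r1; rewrite /lq_norm unlock integral_counting_int.
  congr (_ `^ _)%E; apply: eq_esum => j _ /=.
  by rewrite ger0_norm //; case: (w j) => x y; exact: sqrtr_ge0.
by move=> j; exact: poweR_ge0.
Qed.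

Lemma counting_ge1 (A : set int) j : A j -> (1 <= @counting int R A)%E.
Proof.
move=> Aj; apply: (@le_trans _ _ (@counting int R [set j])).
    by rewrite /counting asboolT// fset_set1 finmap.cardfs1.
apply: (le_measure (@counting int R : {measure set int -> \bar R}));
  by rewrite ?inE// => _ ->.
Qed.

(** Every nonempty set has counting measure at least 1, so null sets are empty and the essential
    supremum is a true supremum. *)
Lemma lq_norm_ooP w (M : \bar R) :
  (lq_norm +oo w <= M)%E <-> forall j, ((normc (w j))%:E <= M)%E.
Proof.
have c0 : (0 < @counting int R [set: int])%E.
  by apply: lt_le_trans (@counting_ge1 setT 0 I); rewrite lte01.
have nE j : (`|(normc (w j))%:E| = (normc (w j))%:E)%E.
  by rewrite gee0_abs// lee_fin; case: (w j) => x y; exact: sqrtr_ge0.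
rewrite /lq_norm unlock c0; split.
  move/ess_supP => [N [mN N0 sN]] j; rewrite -nE.
  apply: contrapT => h; have /sN /counting_ge1 : (~` [set x |
    ((abse \o (fun j0 : int => (normc (w j0))%:E)) x <= M)%E]) j by [].
  by move: N0 => /= ->; rewrite leNgt lte01.
by move=> h; apply/ess_supP; apply: nearW => j; rewrite /comp nE.
Qed.

End lq_norm_theory.

(** * Monotonicity, Minkowski inequality and passage to the limit *)

Section lq_norm_inequalities.
Variable R : realType.
Implicit Types (q : \bar R) (u v w : int -> R[i]).

Lemma normc_ge0 (x : R[i]) : 0 <= normc x.
Proof. by case: x => x y; exact: sqrtr_ge0. Qed.

Lemma normcD_le (x y : R[i]) : normc (x + y) <= normc x + normc y.
Proof. by have := ler_normD x y; rewrite -rmorphD lecR. Qed.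

Lemma lq_norm_ge0 q w : (0 <= lq_norm q w)%E.
Proof. exact: Lnorm_ge0. Qed.

Lemma lq_norm_point q w j : (1 <= q)%E -> ((normc (w j))%:E <= lq_norm q w)%E.
Proof.
case: q => [r|_|//]; last by move: j; apply/lq_norm_ooP.
rewrite lee_fin => r1; rewrite lq_normE//.
have r0 : r != 0 by rewrite gt_eqF// (lt_le_trans _ r1).
have -> : (normc (w j))%:E = (((normc (w j))%:E `^ r) `^ r^-1)%E.
  by rewrite -poweRrM mulfV// poweRe1// lee_fin normc_ge0.
apply: gt0_ler_poweR; rewrite ?in_itv/= ?leey ?andbT.
- by rewrite invr_ge0 (le_trans _ r1).
- by rewrite lee_fin powR_ge0.
- by apply: esum_ge0 => i _; rewrite lee_fin powR_ge0.
apply: esum_ge; exists [set j]; last by rewrite fsbig_set1.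
by split.
Qed.

Lemma lq_norm_mono q u v : (1 <= q)%E ->
  (forall j, normc (u j) <= normc (v j)) -> (lq_norm q u <= lq_norm q v)%E.
Proof.
case: q => [r|_ uv|//]; last first.
  apply/lq_norm_ooP => j; apply: (le_trans _ (@lq_norm_point +oo v j (leey _))).
  by rewrite lee_fin uv.
rewrite lee_fin => r1 uv; rewrite !lq_normE//.
have r0 : 0 <= r by apply: le_trans r1.
apply: gt0_ler_poweR; rewrite ?in_itv/= ?leey ?andbT ?invr_ge0//.
- by apply: esum_ge0 => i _; rewrite lee_fin powR_ge0.
- by apply: esum_ge0 => i _; rewrite lee_fin powR_ge0.
apply: le_esum => j _; rewrite lee_fin.
by apply: ge0_ler_powR; rewrite ?nnegrE ?normc_ge0.
Qed.

Lemma lq_norm_reindex q w (g : int -> int) : (1 <= q)%E -> bijective g ->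
  lq_norm q (w \o g) = lq_norm q w.
Proof.
case: q => [r|_ bg|//].
  rewrite lee_fin => r1 bg; rewrite !lq_normE//; congr (_ `^ _)%E.
  by rewrite [RHS](reindex_esum setT setT g)//; exact: set_bijTT.
have [g' gK g'K] := bg.
apply/le_anti/andP; split; apply/lq_norm_ooP => j.
  exact: lq_norm_point (leey _).
by rewrite -(g'K j); exact: (@lq_norm_point +oo (w \o g) _ (leey _)).
Qed.

(** Minkowski is applied to the real sequences of moduli. The triangle inequality in the complex
    plane first bounds the modulus of the sum by the sum of moduli, itself viewed as a complex
    sequence so that [lq_norm_mono] applies. *)
Lemma lq_normD q u v : (1 <= q)%E ->
  (lq_norm q (u \+ v)%R <= lq_norm q u + lq_norm q v)%E.
Proof.
move=> q1.
have uv : (lq_norm q (u \+ v)%R <=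
    Lnorm (@counting int R) q
      (EFin \o ((fun j => normc (u j)) \+ (fun j => normc (v j)))%R))%E.
  have -> : (EFin \o ((fun j => normc (u j)) \+ (fun j => normc (v j)))%R) =
     (fun j => (normc ((normc (u j) + normc (v j))%:C))%:E).
    apply/funext => j /=; rewrite expr0n addr0 sqrtr_sqr ger0_norm//.
    by rewrite addr_ge0 ?normc_ge0.
  apply: (@lq_norm_mono q _ (fun j => (normc (u j) + normc (v j))%:C)) => // j.
  rewrite /= expr0n addr0 sqrtr_sqr ger0_norm ?addr_ge0 ?normc_ge0//.
  exact: normcD_le.
by apply: (le_trans uv); exact: eminkowski.
Qed.

(** A positive limit is a point where the power is differentiable. At the limit 0 the sequence is
    instead squeezed by t^r <= t, valid for 0 < t <= 1 and r >= 1. *)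
Lemma cvg_powR (r : R) (x : nat -> R) (l : R) : 1 <= r -> (forall n, 0 <= x n) ->
  x @ \oo --> l -> (fun n => x n `^ r) @ \oo --> l `^ r.
Proof.
move=> r1 x0 xl.
have r_gt0 : 0 < r by exact: lt_le_trans r1.
have : 0 <= l by apply: cvgr_to_ge xl _; exact: nearW.
rewrite le_eqVlt => /predU1P[l0|l0]; last first.
  suff : {for l, continuous (fun a : R => a `^ r)} by apply: cvg_comp.
  apply: differentiable_continuous; apply/derivable1_diffP.
  by apply: derivable_powR; rewrite in_itv/= l0.
rewrite -l0 in xl *; rewrite powR0 ?gt_eqF//.
apply: (squeeze_cvgr _ (cvg_cst 0) xl); near=> n.
rewrite powR_ge0/=; have := x0 n; rewrite le_eqVlt => /predU1P[<-|xn0].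
  by rewrite powR0 ?gt_eqF.
apply: ge1r_powR => //; rewrite xn0/= ltW//.
by near: n; apply: (cvgr_lt 0 xl).
Unshelve. all: by end_near. Qed.

(** A Fatou property: for finite exponents the sum is a supremum over finite sets of indices, and
    each finite sum passes to the limit. *)
Lemma lq_norm_lim q (v : nat -> int -> R[i]) w (M : R) : (1 <= q)%E ->
  (forall j, (fun n => normc (v n j)) @ \oo --> normc (w j)) ->
  (forall n, (lq_norm q (v n) <= M%:E)%E) -> (lq_norm q w <= M%:E)%E.
Proof.
move=> q1 vw vM; case: q q1 vM => [r|_|//]; last first.
  move=> vM; apply/lq_norm_ooP => j; rewrite lee_fin.
  apply: (cvgr_to_le (vw j)).
  by apply: nearW => n; rewrite -lee_fin; exact: (lq_norm_ooP _ _).1.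
rewrite lee_fin => r1 vM.
have r0 : 0 < r by apply: lt_le_trans r1.
have M0 : 0 <= M by rewrite -lee_fin (le_trans _ (vM 0%N)) ?lq_norm_ge0.
have vS n : (\esum_(j in [set: int]) (normc (v n j) `^ r)%:E <= (M `^ r)%:E)%E.
  have := vM n; rewrite lq_normE// => h.
  rewrite -[leLHS]poweRe1; last first.
    by apply: esum_ge0 => i _; rewrite lee_fin powR_ge0.
  rewrite -[1](mulVf (lt0r_neq0 r0)) poweRrM -poweR_EFin.
  apply: gt0_ler_poweR => //; rewrite ?in_itv/= ?leey ?andbT ?lee_fin//.
    exact: ltW.
  exact: poweR_ge0.
rewrite lq_normE//.
have -> : M%:E = ((M `^ r)%:E `^ r^-1)%E.
  by rewrite poweR_EFin -powRrM mulfV ?gt_eqF// powRr1.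
apply: gt0_ler_poweR; rewrite ?in_itv/= ?leey ?andbT ?lee_fin ?powR_ge0//.
- by rewrite invr_ge0 ltW.
- by apply: esum_ge0 => i _; rewrite lee_fin powR_ge0.
apply: ge_ereal_sup => _ [X [finX _] <-].
rewrite fsbig_finite//= sumEFin lee_fin.
have : (fun n => \sum_(i <- finmap.enum_fset (fset_set X)) normc (v n i) `^ r) @ \oo -->
  \sum_(i <- finmap.enum_fset (fset_set X)) normc (w i) `^ r.
  apply: cvg_big => // [|i _]; first exact: add_continuous.
  by apply: cvg_powR => // n; exact: normc_ge0.
move/cvgr_to_le; apply; apply: nearW => n.
rewrite -lee_fin; apply: le_trans (vS n); apply: esum_ge; exists X => //.
by rewrite fsbig_finite//= sumEFin.
Qed.

End lq_norm_inequalities.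

Section lq_space.
Variable R : realType.
Implicit Types (q : \bar R) (u v w h : int -> R[i]) (c s : R[i]).

Lemma lq_normZ q c w : (1 <= q)%E ->
  (lq_norm q (c \*o w) <= (normc c)%:E * lq_norm q w)%E.
Proof.
case: q => [r|_|//]; last first.
  apply/lq_norm_ooP => j; rewrite /= normcM EFinM.
  by apply: lee_wpmul2l; [rewrite lee_fin normc_ge0|exact/lq_norm_point/leey].
rewrite lee_fin => r1; have r0 : 0 < r by apply: lt_le_trans r1.
rewrite /lq_norm unlock /=.
under eq_integral.
  move=> j _; rewrite normcM ger0_norm ?mulr_ge0 ?normc_ge0//.
  rewrite powRM ?normc_ge0// EFinM.
  over.
rewrite ge0_integralZl_EFin ?powR_ge0//; last by move=> j _; rewrite lee_fin powR_ge0.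
rewrite poweRM ?lee_fin ?powR_ge0//; last first.
  by apply: integral_ge0 => j _; rewrite lee_fin powR_ge0.
rewrite poweR_EFin -powRrM mulfV ?gt_eqF// powRr1 ?normc_ge0//.
apply: lee_wpmul2l; first by rewrite lee_fin normc_ge0.
under eq_integral.
  move=> j _; rewrite -[normc (w j)]ger0_norm ?normc_ge0//.
  over.
by [].
Qed.

Lemma lq_normEfine q w : lq q w -> lq_norm q w = (fine (lq_norm q w))%:E.
Proof. by move=> lw; rewrite fineK// ge0_fin_numE ?lq_norm_ge0. Qed.

Lemma lq_bounded q w : (1 <= q)%E -> lq q w ->
  forall j, normc (w j) <= fine (lq_norm q w).
Proof.
by move=> q1 lw j; rewrite -lee_fin -lq_normEfine//; exact: lq_norm_point.
Qed.

Lemma lq_dominated q w (M : R) : (lq_norm q w <= M%:E)%E -> lq q w.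
Proof. by move=> h; rewrite /lq/= (le_lt_trans h) ?ltry. Qed.

Lemma lqZ q c w : (1 <= q)%E -> lq q w -> lq q (c \*o w).
Proof.
move=> q1 lw; apply: (@lq_dominated _ _ (normc c * fine (lq_norm q w))).
by rewrite EFinM -lq_normEfine//; exact: lq_normZ.
Qed.

Lemma lqD q u v : (1 <= q)%E -> lq q u -> lq q v -> lq q (u \+ v).
Proof.
move=> q1 lu lv; apply: (le_lt_trans (lq_normD _ _ q1)).
by rewrite lte_add_pinfty.
Qed.

Lemma lq_delta q (k : int) : (1 <= q)%E -> lq q (fun j => (j == k)%:R).
Proof.
case: q => [r|_|//]; last first.
  apply: (@lq_dominated _ _ 1); apply/lq_norm_ooP => j; rewrite lee_fin.
  by case: eqP => _; rewrite ?mulr1n ?mulr0n ?normc1 ?normc0.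
rewrite lee_fin => r1; have r0 : r != 0 by rewrite gt_eqF// (lt_le_trans _ r1).
rewrite /lq/= lq_normE// poweR_lty//.
rewrite (esumID [set k])//; last by move=> i _; rewrite lee_fin powR_ge0.
rewrite setTI esum_set1 ?lee_fin ?powR_ge0// esum1 ?adde0 ?ltry//.
by move=> i [_ /= /eqP/negbTE ->]; rewrite normc0 powR0.
Qed.

(** Iterating gives x_0 = s^n x_n, whose modulus is at most |s|^n D and tends to 0. This is how
    boundedness rules out the growing solution of a recurrence. *)
Lemma bounded_contraction s (x : nat -> R[i]) (D : R) : normc s < 1 ->
  (forall n, x n = s * x n.+1) -> (forall n, normc (x n) <= D) -> x 0%N = 0.
Proof.
move=> s1 xs xD.
have x0 n : x 0%N = s ^+ n * x n.
  elim: n => [|n IH]; first by rewrite mul1r.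
  by rewrite IH xs exprSr mulrA.
apply: eq0_normc; apply/le_anti; rewrite normc_ge0 andbT.
have h : (fun n => normc s ^+ n * D) @ \oo --> 0.
  rewrite -(mul0r D); apply: cvgMl; apply: cvg_expr.
  by rewrite ger0_norm ?normc_ge0.
apply: (cvgr_to_ge h); apply: nearW => n.
have -> : normc s ^+ n = normc (s ^+ n).
  by elim: n => [|n IH]; rewrite ?expr0 ?normc1// !exprS normcM IH.
by rewrite (x0 n) normcM ler_wpM2l ?normc_ge0.
Qed.

End lq_space.

(** * First and second order recurrences on l^q(Z) *)

Section first_order_solve.
Variable R : realType.
Implicit Types (q : \bar R) (u v w h : int -> R[i]) (c s : R[i]).

Lemma normc_ge_Re_Im (x : R[i]) :
  [/\ `|complex.Re x| <= normc x, `|complex.Im x| <= normc x &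
    normc x <= `|complex.Re x| + `|complex.Im x| ].
Proof.
case: x => x y /=; split.
- by rewrite -sqrtr_sqr ler_wsqrtr// lerDl sqr_ge0.
- by rewrite -sqrtr_sqr ler_wsqrtr// lerDr sqr_ge0.
rewrite -[leRHS]ger0_norm ?addr_ge0// -sqrtr_sqr ler_wsqrtr//.
by rewrite sqrrD !real_normK ?num_real// addrAC lerDl mulrn_wge0 ?mulr_ge0.
Qed.

Lemma real_series_cvg (x : nat -> R) (B t : R) : 0 <= t < 1 -> 0 <= B ->
  (forall n, `|x n| <= B * t ^+ n) -> cvgn (series x).
Proof.
move=> /andP[t0 t1] B0 xB; apply: normed_cvg.
apply: (@series_le_cvg _ _ (geometric B t)) => //.
- by move=> n; exact: normr_ge0.
- by move=> n; rewrite /geometric /= mulr_ge0// exprn_ge0.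
- by apply: is_cvg_geometric_series; rewrite ger0_norm.
Qed.

Lemma complex_series_cvg (x : nat -> R[i]) (B t : R) : 0 <= t < 1 -> 0 <= B ->
  (forall n, normc (x n) <= B * t ^+ n) ->
  exists l, (fun N => normc (\sum_(0 <= i < N) x i - l)) @ \oo --> 0.
Proof.
move=> t01 B0 xB.
have /cvg_ex[a ha] : cvgn (series (fun n => complex.Re (x n))).
  apply: (real_series_cvg t01 B0) => n.
  by apply: le_trans (xB n); have [] := normc_ge_Re_Im (x n).
have /cvg_ex[b hb] : cvgn (series (fun n => complex.Im (x n))).
  apply: (real_series_cvg t01 B0) => n.
  by apply: le_trans (xB n); have [] := normc_ge_Re_Im (x n).
exists (a +i* b).
have sE N : \sum_(0 <= i < N) x i =
    (series (fun n => complex.Re (x n)) N +i* series (fun n => complex.Im (x n)) N).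
  rewrite !seriesEnat /=; elim: N => [|N IH]; first by rewrite !big_geq.
  by rewrite !big_nat_recr //= IH; case: (x N).
have h0 : (fun N => `|series (fun n => complex.Re (x n)) N - a| +
                    `|series (fun n => complex.Im (x n)) N - b|) @ \oo --> 0.
  rewrite -[X in _ --> X](addr0 0); apply: cvgD.
    by apply/norm_cvg0P; rewrite -(subrr a); apply: cvgB => //; exact: cvg_cst.
  by apply/norm_cvg0P; rewrite -(subrr b); apply: cvgB => //; exact: cvg_cst.
apply: (squeeze_cvgr _ (cvg_cst 0) h0); apply: nearW => N.
by rewrite normc_ge0 sE; have [] := normc_ge_Re_Im
  ((series (fun n => complex.Re (x n)) N +i* series (fun n => complex.Im (x n)) N)
    - (a +i* b)).
Qed.

Lemma normcNr (x : R[i]) : normc (- x) = normc x.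
Proof. by case: x => x y /=; rewrite !sqrrN. Qed.

Lemma normc_dist (x y : R[i]) : `|normc x - normc y| <= normc (x - y).
Proof.
have h a b : normc a - normc b <= normc (a - b) :> R.
  by rewrite lerBlDr -{1}(subrK b a) normcD_le.
by rewrite ler_norml h andbT lerNl opprB -(normcNr (x - y)) opprB h.
Qed.

Lemma normcX (x : R[i]) n : normc (x ^+ n) = normc x ^+ n.
Proof. by elim: n => [|n IH]; rewrite ?expr0 ?normc1// !exprS normcM IH. Qed.

(** The solution is the series of s^i h(j - i) over i >= 0. Its partial sums [P] obey P_(N+1) = s
    (P_N shifted) + h; the limit of this relation is the equation, and induction on it gives a norm
    bound independent of N, which [lq_norm_lim] transfers to the limit. *)
Lemma first_order_solve q s h : (1 <= q)%E -> normc s < 1 -> lq q h ->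
  exists v, (forall j, v j = s * v (j - 1) + h j) /\
    (lq_norm q v <= (1 - normc s)^-1%:E * lq_norm q h)%E.
Proof.
move=> q1 s1 lh; set H := fine (lq_norm q h).
have HE : lq_norm q h = H%:E := lq_normEfine lh.
have H0 : 0 <= H by rewrite -lee_fin -HE lq_norm_ge0.
pose P (N : nat) (j : int) : R[i] := \sum_(0 <= i < N) s ^+ i * h (j - i%:Z).
have PS N j : P N.+1 j = s * P N (j - 1) + h j.
  rewrite /P big_nat_recl// expr0 mul1r subr0 addrC; congr (_ + _).
  rewrite big_distrr/=; apply: eq_bigr => i _.
  by rewrite exprS mulrA; congr (_ * h _); lia.
have : forall j, exists l, (fun N => normc (P N j - l)) @ \oo --> 0.
  move=> j; apply: (@complex_series_cvg _ H (normc s)) => //.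
    by rewrite normc_ge0.
  move=> n; rewrite normcM normcX mulrC ler_wpM2r ?exprn_ge0 ?normc_ge0//.
  exact: lq_bounded.
move=> /boolp.choice[v vP]; exists v; split.
  move=> j; apply/eqP; rewrite -subr_eq0; apply/eqP; apply: eq0_normc.
  apply/le_anti; rewrite normc_ge0 andbT.
  have h0 : (fun N => normc (P N.+1 j - v j) +
      normc s * normc (P N (j - 1) - v (j - 1))) @ \oo --> 0.
    rewrite -[X in _ --> X](addr0 0); apply: cvgD.
      by have := vP j; rewrite -(cvg_shiftS (fun N => normc (P N j - v j))).
    by rewrite -(mulr0 (normc s)); apply: cvgMr; exact: vP.
  apply: (cvgr_to_ge h0); apply: nearW => N.
  rewrite -normcM -(normcNr (P N.+1 j - v j)) (le_trans _ (normcD_le _ _))//.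
  by rewrite PS le_eqVlt; apply/orP; left; apply/eqP; congr normc; ring.
rewrite HE -EFinM.
apply: (@lq_norm_lim R q P) => // [j|N].
  apply/cvgrPdist_le => e e0; near=> N.
  rewrite distrC (le_trans (normc_dist _ _))//.
  near: N; apply: (cvgr_le 0 (vP j)); exact: e0.
elim: N => [|N IH].
  have -> : P 0%N = (fun j => 0) by apply/funext => j; rewrite /P big_geq.
  have : (lq_norm q (fun j : int => 0%R : R[i]) <= 0%:E * lq_norm q h)%E.
    have <- : (0 : R[i]) \*o h = (fun _ => 0) by apply/funext => j /=; rewrite mul0r.
    by rewrite -(normc0 R); exact: lq_normZ.
  by rewrite mul0e => /le_trans; apply; rewrite lee_fin mulr_ge0// invr_ge0 subr_ge0 ltW.
have -> : P N.+1 = (s \*o (P N \o (fun j => j - 1))) \+ h.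
  by apply/funext => j; rewrite PS.
apply: (le_trans (lq_normD _ _ q1)); rewrite HE.
(* The claimed bound is the fixed point of x -> |s| x + H, hence is preserved by the induction
   step. *)
have -> : (((1 - normc s)^-1 * H)%:E = (normc s * ((1 - normc s)^-1 * H))%:E + H%:E)%E.
  rewrite -EFinD; congr EFin; field; rewrite gt_eqF// subr_gt0//.
rewrite leeD2r// (le_trans (lq_normZ _ _ q1))// lq_norm_reindex//; last first.
  by exists (fun j => j + 1) => j; ring.
by rewrite EFinM lee_wpmul2l ?lee_fin ?normc_ge0.
Unshelve. all: by end_near. Qed.

End first_order_solve.

(** * Second order recurrences and their decaying modes *)

Section second_order.
Variable R : realType.
Implicit Types (q : \bar R) (u v w h : int -> R[i]) (A k s : R[i]).

Lemma first_order_solve_left q k h : (1 <= q)%E -> normc k < 1 -> lq q h ->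
  exists v, (forall j, v j = k * v (j + 1) + h j) /\
    (lq_norm q v <= (1 - normc k)^-1%:E * lq_norm q h)%E.
Proof.
move=> q1 k1 lh.
have bN : bijective (fun j : int => - j) by exists (fun j => - j) => j; rewrite opprK.
have lNh : lq q (h \o -%R) by rewrite /lq/= lq_norm_reindex.
have [v [vE vn]] := first_order_solve q1 k1 lNh.
exists (v \o -%R); split.
  by move=> j; rewrite /= vE /= opprK opprD.
by rewrite lq_norm_reindex// -(lq_norm_reindex h q1 bN).
Qed.

(** With v(j) = w(j) - s w(j - 1) the equation becomes A v(j + 1) - A k v(j) = h(j). Since |k| > 1
    it is solved for v(j) in terms of v(j + 1); then |s| < 1 lets w be recovered from v in the
    opposite direction. The constant is the product of the two bounds. *)
Lemma second_order_solve q A k s : (1 <= q)%E -> A != 0 ->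
  normc s < 1 -> 1 < normc k ->
  exists K : R, forall h, lq q h -> exists w,
    (forall j, A * w (j + 1) - A * (k + s) * w j + A * (k * s) * w (j - 1) = h j) /\
    (lq_norm q w <= K%:E * lq_norm q h)%E.
Proof.
move=> q1 A0 s1 k1.
have k0 : k != 0 by apply: contraTneq k1 => ->; rewrite normc0 ltr10.
have kV1 : normc k^-1 < 1 by rewrite normcV invf_lt1// (lt_trans ltr01).
exists ((1 - normc s)^-1 * ((1 - normc k^-1)^-1 * normc (- (A * k)^-1))) => h lh.
have lh' := lqZ (- (A * k)^-1) q1 lh.
have [v [vE vn]] := first_order_solve_left q1 kV1 lh'.
have lv : lq q v.
  apply: (@lq_dominated _ _ _ _ _); apply: (le_trans vn).
  by rewrite (lq_normEfine lh') -EFinM; exact: lexx.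
have [w [wE wn]] := first_order_solve q1 s1 lv.
exists w; split.
  move=> j; have := wE (j + 1); rewrite addrK => ->.
  rewrite [w j]wE (_ : _ + _ = A * v (j + 1) - A * k * v j); last by ring.
  by rewrite [v j]vE /=; field; rewrite A0 k0.
have pos (x : R[i]) : normc x < 1 -> (0 <= (1 - normc x)^-1%:E)%E.
  by move=> x1; rewrite lee_fin invr_ge0 subr_ge0 ltW.
apply: (le_trans wn); rewrite EFinM -muleA; apply: lee_wpmul2l; first exact: pos.
apply: (le_trans vn); rewrite EFinM -muleA; apply: lee_wpmul2l; first exact: pos.
exact: lq_normZ.
Qed.

(** The defect x_n = w(j - n) - k w(j - n - 1) satisfies x_n = s x_(n+1) by the recurrence at j - n
    - 1, so boundedness forces it to vanish. That index is at most -1 exactly because j <= 0. *)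
Lemma second_order_kernel_left A k s w (D : R) : A != 0 -> normc s < 1 ->
  (forall j, normc (w j) <= D) ->
  (forall j, j <= -1 ->
     A * w (j + 1) - A * (k + s) * w j + A * (k * s) * w (j - 1) = 0) ->
  forall j, j <= 0 -> w j = k * w (j - 1).
Proof.
move=> A0 s1 wD wE j j0; apply/eqP; rewrite -subr_eq0; apply/eqP.
pose x n := w (j - n%:Z) - k * w (j - n%:Z - 1).
have -> : w j - k * w (j - 1) = x 0%N by rewrite /x subr0.
apply: (@bounded_contraction _ s x (D + normc k * D)) => // n.
  apply: (mulfI A0); apply/eqP; rewrite -subr_eq0 -(wE (j - n.+1%:Z)); last by lia.
  have -> : j - n.+1%:Z + 1 = j - n%:Z by lia.
  rewrite /x (_ : j - n%:Z - 1 = j - n.+1%:Z); last by lia.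
  by apply/eqP; ring.
by rewrite (le_trans (normcD_le _ _))// normcNr normcM lerD// ler_wpM2l ?normc_ge0.
Qed.

(** Here the defect x_n = w(j + n + 1) - s w(j + n) satisfies x_(n+1) = k x_n by the recurrence at j
    + n + 1 >= 2, so [bounded_contraction] applies with ratio 1/k. *)
Lemma second_order_kernel_right A k s w (D : R) : A != 0 -> 1 < normc k ->
  (forall j, normc (w j) <= D) ->
  (forall j, 2 <= j ->
     A * w (j + 1) - A * (k + s) * w j + A * (k * s) * w (j - 1) = 0) ->
  forall j, 1 <= j -> w (j + 1) = s * w j.
Proof.
move=> A0 k1 wD wE j j0; apply/eqP; rewrite -subr_eq0; apply/eqP.
have k0 : k != 0 by apply: contraTneq k1 => ->; rewrite normc0 ltr10.
have kV1 : normc k^-1 < 1 by rewrite normcV invf_lt1// (lt_trans ltr01).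
pose x n := w (j + n%:Z + 1) - s * w (j + n%:Z).
have -> : w (j + 1) - s * w j = x 0%N by rewrite /x addr0.
apply: (@bounded_contraction _ k^-1 x (D + normc s * D)) => // n.
  apply: (mulfI (mulf_neq0 A0 k0)); apply/eqP; rewrite eq_sym -subr_eq0.
  rewrite -(wE (j + n.+1%:Z)); last by lia.
  have -> : j + n.+1%:Z - 1 = j + n%:Z by lia.
  rewrite /x (_ : j + n%:Z + 1 = j + n.+1%:Z); last by lia.
  by apply/eqP; field.
by rewrite (le_trans (normcD_le _ _))// normcNr normcM lerD// ler_wpM2l ?normc_ge0.
Qed.

(** Solving the first order recurrence with a unit source at 1 yields the geometric mode cut off on
    the left, with membership in l^q included. To the left of the source the solution is bounded and
    sourceless, hence zero. *)
Lemma right_mode q s : (1 <= q)%E -> normc s < 1 ->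
  exists v, [/\ lq q v, v 1 = 1, (forall j, j <= 0 -> v j = 0) &
    forall j, 1 <= j -> v (j + 1) = s * v j].
Proof.
move=> q1 s1; have ld := @lq_delta R q 1 q1.
have [v [vE vn]] := first_order_solve q1 s1 ld.
have lv : lq q v.
  apply: (@lq_dominated _ _ _ _ _); apply: (le_trans vn).
  by rewrite (lq_normEfine ld) -EFinM; exact: lexx.
have v0 j : j <= 0 -> v j = 0.
  move=> j0; pose x n := v (j - n%:Z); have -> : v j = x 0%N by rewrite /x subr0.
  apply: (@bounded_contraction _ s x (fine (lq_norm q v))) => // n; last exact: lq_bounded.
  rewrite /x vE (_ : (_ == 1) = false) ?addr0; last by lia.
  by congr (_ * v _); lia.
exists v; split => //.
  by rewrite vE subrr v0// mulr0 add0r.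
move=> j j1; rewrite vE addrK (_ : (_ == 1) = false) ?addr0//; lia.
Qed.

(** The reflection j -> 1 - j exchanges the two half-lines and carries the right mode of ratio 1/k
    to this one. *)
Lemma left_mode q k : (1 <= q)%E -> 1 < normc k ->
  exists v, [/\ lq q v, v 0 = 1, (forall j, 1 <= j -> v j = 0) &
    forall j, j <= 0 -> v j = k * v (j - 1)].
Proof.
move=> q1 k1.
have k0 : k != 0 by apply: contraTneq k1 => ->; rewrite normc0 ltr10.
have kV1 : normc k^-1 < 1 by rewrite normcV invf_lt1// (lt_trans ltr01).
have [v [lv v1 v0 vS]] := right_mode q1 kV1.
exists (v \o (fun j => 1 - j)); split => /=.
- rewrite /lq/= lq_norm_reindex//.
  by exists (fun j => 1 - j) => j; ring.
- by rewrite subr0.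
- by move=> j j1; apply: v0; lia.
move=> j j0; rewrite (_ : 1 - (j - 1) = 1 - j + 1); last by ring.
by rewrite vS ?mulrA ?mulfV ?mul1r//; lia.
Qed.

End second_order.

(** * Roots of the characteristic equation *)

Section roots.
Variable R : realType.
Implicit Types (a : R) (z k : R[i]).

Lemma normc_sqr (x : R[i]) : normc x ^+ 2 = complex.Re x ^+ 2 + complex.Im x ^+ 2.
Proof. by case: x => x y; rewrite /= sqr_sqrtr// addr_ge0 ?sqr_ge0. Qed.

Lemma char_eq_Re_Im a z k : char_eq a z k ->
  let: x +i* y := k in let: X +i* Y := z in
  a * (a - 1) / 2 * (x * x - y * y) + ((1 - a * a - X) * x + Y * y)
    + a * (a + 1) / 2 = 0 /\
  a * (a - 1) / 2 * (x * y + y * x) + ((1 - a * a - X) * y - Y * x) = 0.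
Proof.
rewrite /char_eq; case: k => x y; case: z => X Y /=.
have -> : (2 : R[i])^-1 = (2^-1 : R)%:C by rewrite fmorphV/= rmorphMn/= rmorph1.
by rewrite /GRing.one /GRing.exp /=; simpc => /= -[re im].
Qed.

(* Multiplied by normc k ^+ 2 so as to be polynomial in k. *)
Lemma char_eq_normc a z k : char_eq a z k ->
  let m := a * (a - 1) / 2 * normc k ^+ 2 + a * (a + 1) / 2 in
  normc k ^+ 2 * (a ^+ 2 * normc k ^+ 2 * normc z ^+ 2) =
  normc k ^+ 2 * ((1 - a ^+ 2) * a ^+ 2 * normc k ^+ 2 + m ^+ 2
    - (1 - a ^+ 2) * (m - a ^+ 2 * complex.Re k) ^+ 2).
Proof.
move=> /char_eq_Re_Im; rewrite !normc_sqr; case: k => x y; case: z => X Y /= [re im].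
(* [e1] and [e2] come from the real and imaginary parts of the equation multiplied by the conjugate
   of k; they give |k|^2 z explicitly. *)
have e1 : (x ^+ 2 + y ^+ 2) * X = (1 - a ^+ 2) * (x ^+ 2 + y ^+ 2)
   + (a * (a - 1) / 2 * (x ^+ 2 + y ^+ 2) + a * (a + 1) / 2) * x.
  apply/esym/eqP; rewrite -subr_eq0; apply/eqP.
  by have := congr2 (fun s t => x * s + y * t) re im; rewrite !mulr0 addr0 => <-; field.
have e2 : (x ^+ 2 + y ^+ 2) * Y =
   (a * (a - 1) / 2 * (x ^+ 2 + y ^+ 2) - a * (a + 1) / 2) * y.
  apply/eqP; rewrite -subr_eq0; apply/eqP.
  have := congr2 (fun s t => y * s - x * t) re im; rewrite !mulr0 subr0 => h.
  by rewrite -[LHS]opprK -h; field.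
transitivity (a ^+ 2 * (((x ^+ 2 + y ^+ 2) * X) ^+ 2 + ((x ^+ 2 + y ^+ 2) * Y) ^+ 2)).
  by ring.
by rewrite e1 e2; field.
Qed.

(** The bounds on n = |k|^2 give 0 <= m <= a^2. The modulus identity with |z| >= 1 then yields a^2 n
    <= (1 - a^2) a^2 n + a^4, that is n <= 1. Equality everywhere forces Re k = 1, hence k = 1, and
    the characteristic equation at k = 1 reads z = 1. *)
Lemma root_annulus a z k : 0 < a < 1 -> char_eq a z k ->
  1 <= normc k -> normc k ^+ 2 * (1 - a) <= 1 + a -> 1 <= normc z -> z = 1.
Proof.
move=> /andP[a0 a1] ck k1 kp z1; have /= := char_eq_normc ck.
have k2 : 1 <= normc k ^+ 2 by rewrite exprn_ege1.
have z2 : 1 <= normc z ^+ 2 by rewrite exprn_ege1.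
have k0 : normc k ^+ 2 != 0 by rewrite gt_eqF// (lt_le_trans ltr01).
move=> /(mulfI k0); set m := _ + a * (a + 1) / 2 => E.
set n := normc k ^+ 2 in kp k2 k0 m E *.
have m0 : 0 <= m.
  rewrite (_ : m = a / 2 * (1 + a - n * (1 - a))); last by rewrite /m; field.
  by rewrite mulr_ge0 ?subr_ge0// divr_ge0 ?ltW.
have ma : m <= a ^+ 2.
  rewrite -subr_ge0 (_ : _ - m = a / 2 * (1 - a) * (n - 1)); last by rewrite /m; field.
  by apply: mulr_ge0; [apply: mulr_ge0|]; lra.
have mm : m ^+ 2 <= a ^+ 4.
  have -> : a ^+ 4 = (a ^+ 2) ^+ 2 by ring.
  by rewrite ler_sqr ?nnegrE ?sqr_ge0.
have sq : 0 <= (1 - a ^+ 2) * (m - a ^+ 2 * complex.Re k) ^+ 2.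
  by rewrite mulr_ge0 ?sqr_ge0// subr_ge0 expr_le1// ltW.
have a2 : 0 < a ^+ 2 by rewrite exprn_gt0.
have : a ^+ 2 * n <= a ^+ 2 * n * normc z ^+ 2.
  by rewrite ler_peMr// mulr_ge0 ?ltW// (lt_le_trans ltr01).
rewrite E => E2.
have a4 : a ^+ 4 = a ^+ 2 * a ^+ 2 by ring.
have a40 : 0 < a ^+ 4 by rewrite exprn_gt0.
have n1 : n = 1.
  apply/le_anti; rewrite k2 andbT -(ler_pM2l a40).
  by nra.
have m1 : m = a ^+ 2 by rewrite /m n1; field.
have : (1 - a ^+ 2) * (m - a ^+ 2 * complex.Re k) ^+ 2 <= 0.
  by move: E2; rewrite m1 n1 => E2; nra.
rewrite pmulr_rle0; last by rewrite subr_gt0 expr_lt1// ltW.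
move=> h; have /eqP : (m - a ^+ 2 * complex.Re k) ^+ 2 = 0.
  by apply/le_anti; rewrite h sqr_ge0.
rewrite sqrf_eq0 m1 -{1}(mulr1 (a ^+ 2)) -mulrBr mulf_eq0 gt_eqF//= subr_eq0 => /eqP x1.
have : complex.Im k = 0.
  apply/eqP; rewrite -sqrf_eq0; apply/eqP.
  by move: n1; rewrite /n normc_sqr -x1 expr1n => /(canRL (addKr _)) ->; rewrite addNr.
case: k x1 ck {k1 kp k2 k0 m E n m0 ma mm sq E2 n1 m1 h} => x y /= <- /[swap] ->.
rewrite /char_eq (_ : 1 +i* 0 = 1 :> R[i])// => h.
apply/eqP; rewrite eq_sym -subr_eq0; apply/eqP; by rewrite -h; field.
Qed.

(** The hypothesis on |k| says m = 0, which leaves a^2 n |z|^2 = (1 - a^2) a^2 n minus a nonnegative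
    term. *)
Lemma equal_modulus a z k : a != 0 -> -1 < a < 1 -> char_eq a z k ->
  normc k ^+ 2 * (1 - a) = 1 + a -> normc z <= Num.sqrt (1 - a ^+ 2).
Proof.
move=> a0 /andP[Na1 a1] ck kp; have /= := char_eq_normc ck.
have k0 : 0 < normc k ^+ 2.
  have h : 0 < normc k ^+ 2 * (1 - a) by rewrite kp; lra.
  by rewrite -(pmulr_lgt0 _ (_ : 0 < 1 - a))// subr_gt0.
move=> /(mulfI (lt0r_neq0 k0)).
have -> : a * (a - 1) / 2 * normc k ^+ 2 + a * (a + 1) / 2 = 0.
  by transitivity (a / 2 * (1 + a - normc k ^+ 2 * (1 - a))); [field|rewrite kp subrr mulr0].
move=> E.
have a2 : 0 < a ^+ 2 by rewrite exprn_even_gt0.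
have a21 : 0 <= 1 - a ^+ 2 by nra.
rewrite -[leLHS]ger0_norm ?normc_ge0// -sqrtr_sqr ler_wsqrtr//.
rewrite -(ler_pM2l (mulr_gt0 a2 k0)) E.
rewrite expr0n/= addr0 sub0r sqrrN lerBlDr.
have : 0 <= (1 - a ^+ 2) * (a ^+ 2 * complex.Re k) ^+ 2 by rewrite mulr_ge0 ?sqr_ge0.
lra.
Qed.

(** Reflecting space changes the sign of the velocity and inverts the roots; this reduces a < 0 to a
    > 0. *)
Lemma char_eq_inv a z k : k != 0 -> char_eq a z k -> char_eq (- a) z k^-1.
Proof.
move=> k0; rewrite /char_eq => h.
by apply: (mulfI (expf_neq0 2 k0)); rewrite mulr0 -h rmorphN; field.
Qed.

Lemma normc_real (x : R) : normc x%:C = `|x|.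
Proof. by rewrite /= expr0n addr0 sqrtr_sqr. Qed.

Lemma root_modulus_prod a k k' : a != 0 -> -1 < a < 1 ->
  a%:C * (a%:C - 1) / 2 * (k * k') = a%:C * (a%:C + 1) / 2 ->
  normc k * normc k' * (1 - a) = 1 + a.
Proof.
move=> a0 /andP[Na1 a1] prod.
have aC0 : a%:C != 0 :> R[i] by rewrite fmorph_eq0.
have : (k * k') * (1 - a)%:C = - (1 + a)%:C.
  apply: (mulfI aC0); rewrite rmorphB rmorphD rmorph1.
  transitivity (- 2 * (a%:C * (a%:C - 1) / 2 * (k * k'))); first by field.
  by rewrite prod; field.
move/(congr1 (@normc R)); rewrite normcNr !normcM !normc_real.
by rewrite !ger0_norm//; lra.
Qed.

(** For either coefficient, [kappa_r a] is the small root and [kappa_l a] the large one. The roots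
    come from the quadratic formula; if their moduli agreed, the product relation would put them in
    the case of [equal_modulus], contradicting the bound on z. Strict ordering then makes both
    choices by [xget] unambiguous. *)
Lemma kappa_spec a z : a != 0 -> -1 < a < 1 -> Num.sqrt (1 - a ^+ 2) < normc z ->
  [/\ forall k, char_eq a z k <-> k = kappa_r a z \/ k = kappa_l a z,
      0 < normc (kappa_r a z) < normc (kappa_l a z),
      a%:C * (a%:C - 1) / 2 * (kappa_r a z * kappa_l a z) = a%:C * (a%:C + 1) / 2 &
      a%:C * (a%:C - 1) / 2 * (kappa_r a z + kappa_l a z) = z - 1 + a%:C ^+ 2].
Proof.
move=> a0 a11 dz; have /andP[Na1 a1] := a11.
have aC0 : a%:C != 0 :> R[i] by rewrite fmorph_eq0.
have aC1 : a%:C - 1 != 0 :> R[i].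
  by rewrite -(rmorph1 (real_complex R)) -rmorphB fmorph_eq0 subr_eq0 lt_eqF.
have A0 : a%:C * (a%:C - 1) / 2 != 0 :> R[i] by rewrite !mulf_neq0.
set A := a%:C * (a%:C - 1) / 2 in A0 *.
pose d := sqrtc ((1 - a%:C ^+ 2 - z) ^+ 2 - 4 * A * (a%:C * (a%:C + 1) / 2)).
pose r1 := (z - 1 + a%:C ^+ 2 + d) / (2 * A).
pose r2 := (z - 1 + a%:C ^+ 2 - d) / (2 * A).
have rsum : A * (r1 + r2) = z - 1 + a%:C ^+ 2.
  by rewrite /r1 /r2; field.
have rprod : A * (r1 * r2) = a%:C * (a%:C + 1) / 2.
  transitivity (((z - 1 + a%:C ^+ 2) ^+ 2 - d ^+ 2) / (4 * A)); first by rewrite /r1 /r2; field.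
  by rewrite sqr_sqrtc; field.
(* From here only the symmetric relations on the two roots are used, so they may be swapped to order
   their moduli. *)
clearbody r1 r2; clear d.
have rP k : char_eq a z k <-> k = r1 \/ k = r2.
  have -> : char_eq a z k <-> A * ((k - r1) * (k - r2)) = 0.
    rewrite /char_eq -/A -rprod.
    have -> : 1 - a%:C ^+ 2 - z = - (A * (r1 + r2)) by rewrite rsum; ring.
    by rewrite (_ : _ + _ = A * ((k - r1) * (k - r2))); [|ring].
  split=> [/eqP|[]->]; rewrite ?subrr ?mul0r ?mulr0//.
  by rewrite mulf_eq0 (negbTE A0) mulf_eq0 !subr_eq0/= => /orP[]/eqP; [left|right].
have np : normc r1 * normc r2 * (1 - a) = 1 + a.
  exact: root_modulus_prod.
wlog le12 : r1 r2 rsum rprod rP np / normc r1 <= normc r2.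
  move=> H; have [le12|le21] := leP (normc r1) (normc r2); first exact: (H r1 r2).
  apply: (H r2 r1); rewrite 1?[r2 + _]addrC 1?[r2 * _]mulrC 1?[normc r2 * _]mulrC ?ltW//.
  by move=> k; rewrite rP; split=> -[]; [right|left|right|left].
have ne12 : normc r1 != normc r2.
  apply/eqP => e12; have := dz; rewrite ltNge => /negP; apply.
  by apply: (@equal_modulus _ _ r1) => //; [apply/rP; left|rewrite expr2 {2}e12].
have lt12 : normc r1 < normc r2 by rewrite lt_neqAle ne12.
have r10 : 0 < normc r1.
  rewrite lt_neqAle normc_ge0 andbT; apply/eqP => r10.
  by move: np; rewrite -r10 !mul0r => np; lra.
have lE : kappa_l a z = r2.
  rewrite /kappa_l; case: xgetP => [k _ [/rP[]->//]|/(_ r2)[]].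
    by move=> /(_ r2 ((rP r2).2 (or_intror erefl))); rewrite leNgt lt12.
  by split=> [|k /rP[]->//]; apply/rP; right.
have rE : kappa_r a z = r1.
  rewrite /kappa_r; case: xgetP => [k _ [/rP[]->//]|/(_ r1)[]].
    by move=> /(_ r1 ((rP r1).2 (or_introl erefl))); rewrite leNgt lt12.
  by split=> [|k /rP[]->//]; apply/rP; left.
by rewrite lE rE; split => //; rewrite r10.
Qed.

Lemma sqrt_lt_normc a z : a != 0 -> 1 <= normc z -> Num.sqrt (1 - a ^+ 2) < normc z.
Proof.
move=> a0 z1; apply: lt_le_trans z1; rewrite -[ltRHS]sqrtr1 ltr_sqrt//.
by rewrite gtrBl exprn_even_gt0.
Qed.

(** The moduli have product (1 + a)/(1 - a). For a > 0, |r| >= 1 together with |r|^2 <= |r| |l|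
    would put r in the excluded annulus; so |r| < 1, and the product being at least 1 gives |l| > 1.
    For a < 0 the same argument runs on 1/l with coefficient -a. *)
Lemma kappa_modulus a z : a != 0 -> -1 < a < 1 -> 1 <= normc z -> z <> 1 ->
  normc (kappa_r a z) < 1 < normc (kappa_l a z).
Proof.
move=> a0 a11 z1 zn1.
have [kP /andP[r0 rl] prod _] := kappa_spec a0 a11 (sqrt_lt_normc a0 z1).
set r := kappa_r a z in kP r0 rl prod *; set l := kappa_l a z in kP rl prod *.
have l0 : 0 < normc l by exact: lt_trans rl.
have nz (x : R[i]) : 0 < normc x -> x != 0.
  by move=> x0; apply: contraTneq x0 => ->; rewrite normc0 ltxx.
have cr : char_eq a z r by apply/kP; left.
have cl : char_eq a z l by apply/kP; right.
have np := root_modulus_prod a0 a11 prod.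
move/andP: a11 => [Na1 a1].
have [ap|an|a00] := ltgtP 0 a; last by rewrite a00 eqxx in a0.
- have r1 : normc r < 1.
    rewrite ltNge; apply/negP => r1; apply: zn1.
    apply: (@root_annulus a z r) => //; first by rewrite ap.
    rewrite -np expr2; apply: ler_wpM2r; first by rewrite subr_ge0 ltW.
    by apply: ler_wpM2l; apply: ltW.
  rewrite r1 /=; rewrite -(ltr_pM2l r0) mulr1 (lt_le_trans r1)//.
  have : 0 <= (normc r * normc l - 1) * (1 - a) by lra.
  by rewrite pmulr_lge0 ?subr_gt0// subr_ge0.
- have l1 : normc l^-1 < 1.
    rewrite ltNge; apply/negP => l1; apply: zn1.
    apply: (@root_annulus (- a) z l^-1) => //; first by rewrite oppr_gt0 an ltrNl.
      exact: char_eq_inv (nz _ l0) cl.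
    rewrite opprK -[1 - a]mul1r -np normcV expr2 -mulrA.
    rewrite (_ : _ * _ = normc r / normc l * (1 - a)); last by field; rewrite gt_eqF.
    apply: ler_wpM2r; first by rewrite subr_ge0 ltW.
    by rewrite ler_pdivrMr// mul1r ltW.
  rewrite normcV invf_lt1// in l1; rewrite l1 andbT.
  have : 0 < (1 - normc r * normc l) * (1 - a) by lra.
  rewrite pmulr_lgt0 ?subr_gt0// => /(le_lt_trans _); apply.
  by apply: ler_peMr; apply: ltW.
Qed.

End roots.

(** * Holomorphy of the Lopatinskii determinant *)

Section holomorphy.
Variable R : realType.
Implicit Types (a : R) (z w k : R[i]^o).

Lemma ltC_normc (x : R[i]) (e : R[i]) : 0 < e -> (`|x| < e) = (normc x < complex.Re e).
Proof.
case: e => e f; rewrite ltcE/= => /andP[/eqP-> _].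
by rewrite [`|x|](_ : _ = (normc x)%:C)// ltcE /= eqxx.
Qed.

Lemma nbhs_normc (z : R[i]^o) (P : set R[i]^o) (e : R) : 0 < e ->
  (forall w, normc (w - z) < e -> P w) -> nbhs z P.
Proof.
move=> e0 h; apply/nbhs_ballP; exists e%:C; first by rewrite /= ltcE /= eqxx.
by move=> w; rewrite -ball_normE /= distrC ltcR => /h.
Qed.

Lemma normc_gt0 (x : R[i]) : x != 0 -> 0 < normc x.
Proof.
by move=> x0; rewrite lt0r normc_ge0 andbT; apply: contra x0 => /eqP/eq0_normc ->.
Qed.

(* For a root f w of the characteristic equation at w, the first conjunct is that
   equation rewritten around z, with k the other root at z; the second keeps f w
   uniformly away from k. *)
Lemma implicit_derivable (f : R[i]^o -> R[i]^o) z (A k : R[i]) (M : R) :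
  A != 0 -> k != 0 -> f z != k ->
  (\forall w \near z, A * (f w - f z) * (f w - k) = (w - z) * f w /\
     normc (f w) <= M * normc (f w - k)) ->
  derivable f z 1.
Proof.
move=> A0 k0 fzk near_f.
have near_g : \forall w \near z, f w - f z = (w - z) * (f w / (A * (f w - k))) /\
    normc (f w - f z) <= normc (w - z) * (M / normc A).
  near=> w.
  have [E Mw] : A * (f w - f z) * (f w - k) = (w - z) * f w /\
     normc (f w) <= M * normc (f w - k) by near: w.
  (* If f w were equal to k, the bound would give f w = 0, hence k = 0. *)
  have fk : f w - k != 0.
    apply: contraNneq k0 => h; move: Mw; rewrite h normc0 mulr0 => fw0.
    have /eq0_normc fwE : normc (f w) = 0 by apply/le_anti; rewrite fw0 normc_ge0.
    by move: h; rewrite fwE sub0r => /eqP; rewrite oppr_eq0.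
  have E' : f w - f z = (w - z) * (f w / (A * (f w - k))).
    rewrite mulrA -E; by field; rewrite fk A0.
  split; first exact: E'.
  have nA := normc_gt0 A0; have nf := normc_gt0 fk.
  rewrite E' normcM; apply: ler_wpM2l; first exact: normc_ge0.
  rewrite normcM normcV normcM.
  rewrite (_ : _ / (_ * _) = normc (f w) / normc (f w - k) / normc A); last first.
    by field; rewrite !gt_eqF.
  by apply: ler_wpM2r; [rewrite invr_ge0 ltW|rewrite ler_pdivrMr].
have fc : f w @[w --> z] --> f z.
  apply/(@cvgrPdist_lt R[i] R[i]^o R[i]^o (nbhs z) (nbhs_filter z) f (f z)) => e e0.
  have re0 : 0 < complex.Re e by move: e0; case: (e) => x y; rewrite ltcE/= => /andP[].
  (* Adding 1 to the absolute value makes the Lipschitz constant positive whatever [M] is. *)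
  pose C := `|M / normc A| + 1.
  have C0 : 0 < C by rewrite ltr_wpDl.
  have near_z : \forall w \near z, normc (w - z) < complex.Re e / C.
    by apply: (@nbhs_normc z _ (complex.Re e / C)) => //; rewrite divr_gt0.
  move: near_g near_z; apply: filterS2 => w [_ le_fw].
  rewrite distrC ltC_normc//.
  rewrite ltr_pdivlMr//; apply: le_lt_trans; apply: (le_trans le_fw).
  apply: ler_wpM2l; first exact: normc_ge0.
  by rewrite (le_trans (ler_norm _))// lerDl.
have fzk0 : A * (f z - k) != 0 by rewrite mulf_neq0// subr_eq0.
pose F := nbhs_filter z.
have lim0 := @cvgB R[i] R[i]^o R[i]^o (nbhs z) F f (fun=> k) (f z) k fc
  (@cvg_cst _ (k : R[i]^o) _ _ F).
have lim1 := @cvgM R[i] R[i]^o (nbhs z) F (fun=> A) _ A (f z - k)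
  (@cvg_cst _ (A : R[i]^o) _ _ F) lim0.
have lim2 := @cvgV R[i] R[i]^o (nbhs z) F _ _ fzk0 lim1.
have lim := @cvgM R[i] R[i]^o (nbhs z) F f _ (f z) _ fc lim2.
(* The difference quotient equals f w / (A (f w - k)), so continuity of f at z already gives its
   limit. *)
apply/cvg_ex; exists (f z / (A * (f z - k))).
apply/cvgrPdist_lt => e e0.
have near_z : \forall w \near z, `|f z / (A * (f z - k)) - f w / (A * (f w - k))| < e /\
    f w - f z = (w - z) * (f w / (A * (f w - k))).
  have lim_e := (@cvgrPdist_lt R[i] R[i]^o R[i]^o (nbhs z) F _ _).1 lim _ e0.
  by move: lim_e near_g; apply: filterS2 => w ? [].
move/nbhs0P: near_z => near_0.
near=> h.
have h0 : h != 0 by near: h; exact: nbhs_dnbhs_neq.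
have [lt_e E] : `|f z / (A * (f z - k)) - f (z + h) / (A * (f (z + h) - k))| < e /\
    f (z + h) - f z = (z + h - z) * (f (z + h) / (A * (f (z + h) - k))).
  by near: h; apply: nbhs_dnbhs; exact: near_0.
rewrite /= (_ : h *: 1 = h); last exact: mulr1.
rewrite (addrC h) E (addrC z h) addrK (_ : h^-1 *: _ = f (h + z) / (A * (f (h + z) - k))).
  by rewrite (addrC h).
exact: (mulKf h0).
Unshelve. all: by end_near. Qed.

Lemma open_Lopatinskii_domain (al ar : R) : open (Lopatinskii_domain al ar : set R[i]^o).
Proof.
rewrite openE => z; rewrite /Lopatinskii_domain /=; set m := Num.max _ _ => dz.
apply: (@nbhs_normc _ _ (normc z - m)); first by rewrite subr_gt0.
move=> w wz; rewrite /Lopatinskii_domain /= -/m.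
have := le_lt_trans (normc_dist w z) wz; rewrite ltr_norml => /andP[h _]; lra.
Qed.

Lemma near_domain a z : Num.sqrt (1 - a ^+ 2) < normc z ->
  \forall w \near z, Num.sqrt (1 - a ^+ 2) < normc (w : R[i]).
Proof.
move=> dz; apply: (@nbhs_normc _ _ (normc z - Num.sqrt (1 - a ^+ 2))).
  by rewrite subr_gt0.
move=> w wz.
have := le_lt_trans (normc_dist w z) wz; rewrite ltr_norml => /andP[h _]; lra.
Qed.

(** By Vieta the left side is the characteristic polynomial at z evaluated at k'. The polynomials at
    z and w differ only by (w - z) times the variable, and k' is a root at w. *)
Lemma char_eq_diff a z w k k' k2 :
  char_eq a w k' ->
  a%:C * (a%:C - 1) / 2 * (k * k2) = a%:C * (a%:C + 1) / 2 ->
  a%:C * (a%:C - 1) / 2 * (k + k2) = z - 1 + a%:C ^+ 2 ->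
  a%:C * (a%:C - 1) / 2 * (k' - k) * (k' - k2) = (w - z) * k'.
Proof.
rewrite /char_eq; set A := _ / 2 => /eqP ck pr sm.
have -> : z = A * (k + k2) + 1 - a%:C ^+ 2 by rewrite sm; ring.
by rewrite -[RHS]addr0 -(eqP ck) -pr; ring.
Qed.

Lemma leading_coef_neq0 a : a != 0 -> -1 < a < 1 ->
  a%:C * (a%:C - 1) / 2 != 0 :> R[i].
Proof.
move=> a0 /andP[_ a1]; rewrite !mulf_neq0 ?fmorph_eq0//.
by rewrite -(rmorph1 (real_complex R)) -rmorphB fmorph_eq0 subr_eq0 lt_eqF.
Qed.

(** The separating value is the geometric mean of the two moduli. It depends on a alone, so it keeps
    the two branches apart uniformly in z. *)
Lemma modulus_mean a z : a != 0 -> -1 < a < 1 -> Num.sqrt (1 - a ^+ 2) < normc z ->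
  normc (kappa_r a z) < Num.sqrt ((1 + a) / (1 - a)) < normc (kappa_l a z).
Proof.
move=> a0 a11 dz; have [_ /andP[r0 rl] prod _] := kappa_spec a0 a11 dz.
have np := root_modulus_prod a0 a11 prod.
have /andP[_ a1] := a11; have l0 := lt_trans r0 rl.
have -> : (1 + a) / (1 - a) = normc (kappa_r a z) * normc (kappa_l a z).
  by rewrite -np mulfK// gt_eqF// subr_gt0.
rewrite -{1}[normc (kappa_r a z)]ger0_norm ?normc_ge0//.
rewrite -{3}[normc (kappa_l a z)]ger0_norm ?normc_ge0// -!sqrtr_sqr.
by rewrite !ltr_sqrt ?expr2 ?mulr_gt0// ltr_pM2l// ltr_pM2r// rl.
Qed.

Lemma derivable_kappa_l a z : a != 0 -> -1 < a < 1 ->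
  Num.sqrt (1 - a ^+ 2) < normc z ->
  derivable (kappa_l a : R[i]^o -> R[i]^o) z 1.
Proof.
move=> a0 a11 dz; have [_ /andP[r0 rl] prod sum] := kappa_spec a0 a11 dz.
have /andP[rg lg] := modulus_mean a0 a11 dz.
set g := Num.sqrt ((1 + a) / (1 - a)) in rg lg.
set r := kappa_r a z in r0 rl prod sum rg; set l := kappa_l a z in rl prod sum lg.
(* For x >= g > |r| the ratio x / (x - |r|) decreases in x, so its value at g is a uniform bound. *)
apply: (@implicit_derivable _ z (a%:C * (a%:C - 1) / 2) r (g / (g - normc r))).
- exact: leading_coef_neq0.
- by apply: contraTneq r0 => ->; rewrite normc0 ltxx.
- by apply: contraTneq rl => <-; rewrite ltxx.
have := near_domain dz; apply: filterS => w dw.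
have [kP _ _ _] := kappa_spec a0 a11 dw.
split.
  by apply: char_eq_diff; [apply/kP; right|rewrite [l * r]mulrC|rewrite [l + r]addrC].
have /andP[_ /ltW gl] := modulus_mean a0 a11 dw; rewrite -/g in gl.
have := normc_dist (kappa_l a w) r; rewrite ler_norml => /andP[_ h].
have gr : 0 < g - normc r by rewrite subr_gt0.
rewrite mulrAC ler_pdivlMr//; apply: le_trans (_ : g * (normc (kappa_l a w) - normc r) <= _).
  rewrite !mulrBr mulrC lerD2l lerN2.
  by apply: ler_wpM2r; rewrite ?normc_ge0.
by apply: ler_wpM2l => //; exact: sqrtr_ge0.
Qed.

Lemma derivable_kappa_r a z : a != 0 -> -1 < a < 1 ->
  Num.sqrt (1 - a ^+ 2) < normc z ->
  derivable (kappa_r a : R[i]^o -> R[i]^o) z 1.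
Proof.
move=> a0 a11 dz; have [_ /andP[r0 rl] prod sum] := kappa_spec a0 a11 dz.
have /andP[rg lg] := modulus_mean a0 a11 dz.
set g := Num.sqrt ((1 + a) / (1 - a)) in rg lg.
set r := kappa_r a z in r0 rl prod sum rg; set l := kappa_l a z in rl prod sum lg.
(* For 0 <= x <= g < |l| the ratio x / (|l| - x) increases in x, so its value at g is a uniform
   bound. *)
apply: (@implicit_derivable _ z (a%:C * (a%:C - 1) / 2) l (g / (normc l - g))).
- exact: leading_coef_neq0.
- by apply: contraTneq (lt_trans r0 rl) => ->; rewrite normc0 ltxx.
- by apply: contraTneq rl => <-; rewrite ltxx.
have := near_domain dz; apply: filterS => w dw.
have [kP _ _ _] := kappa_spec a0 a11 dw.
split; first by apply: char_eq_diff; [apply/kP; left| |].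
have /andP[/ltW gl _] := modulus_mean a0 a11 dw; rewrite -/g in gl.
have := normc_dist (kappa_r a w) l; rewrite ler_norml => /andP[h _].
have gr : 0 < normc l - g by rewrite subr_gt0.
rewrite mulrAC ler_pdivlMr//; apply: le_trans (_ : g * (normc l - normc (kappa_r a w)) <= _).
  rewrite !mulrBr [_ * normc l]mulrC [_ * g]mulrC lerD2r [leRHS]mulrC.
  by apply: ler_wpM2l; rewrite ?normc_ge0.
by apply: ler_wpM2l; [exact: sqrtr_ge0|rewrite -lerN2 opprB].
Qed.

Lemma derivable_Lopatinskii al ar am z : al != 0 -> -1 < al < 1 ->
  ar != 0 -> -1 < ar < 1 -> Lopatinskii_domain al ar z ->
  derivable (Lopatinskii al ar am) z 1.
Proof.
move=> al0 al1 ar0 ar1; rewrite /Lopatinskii_domain/= gt_max => /andP[dl dr].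
have dkl := derivable_kappa_l al0 al1 dl.
have dkr := derivable_kappa_r ar0 ar1 dr.
have [_ /andP[r0 _] _ _] := kappa_spec ar0 ar1 dr.
have kr0 : kappa_r ar z != 0 by apply: contraTneq r0 => ->; rewrite normc0 ltxx.
have dc (c : R[i]^o) : derivable (fun _ : R[i]^o => c) z 1 by exact: derivable_cst.
have d1 := @derivableM R[i] R[i]^o (fun=> 1 - al%:C) (kappa_l al) z 1 (dc _) dkl.
have d2 := @derivableD R[i] R[i]^o R[i]^o (fun=> al%:C - am%:C) _ z 1 (dc _) d1.
have d3 := @derivableV R[i] R[i]^o (kappa_r ar) z 1 kr0 dkr.
have d4 := @derivableM R[i] R[i]^o (fun=> 1 + ar%:C) _ z 1 (dc _) d3.
have d5 := @derivableB R[i] R[i]^o R[i]^o (fun=> ar%:C - am%:C) _ z 1 (dc _) d4.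
have d6 := @derivableM R[i] R[i]^o _ _ z 1 d2 d5.
exact: (@derivableD R[i] R[i]^o R[i]^o (fun=> 1 - am%:C ^+ 2) _ z 1 (dc _) d6).
Qed.

End holomorphy.

(** * The eigenvalue 1 *)

Section eigenvalue.
Variable R : realType.
Implicit Types (al ar am : R) (u v w : int -> R[i]) (z k l s : R[i]).

Definition left_factor al am l : R[i] := al%:C - am%:C + (1 - al%:C) * l.
Definition right_factor ar am s : R[i] := ar%:C - am%:C - (1 + ar%:C) / s.

Lemma interior_residual (a : R) z w j : z * w j - lax_wendroff_interior a w j =
  - (a%:C * (a%:C - 1) / 2 * w (j + 1) + (1 - a%:C ^+ 2 - z) * w j
     + a%:C * (a%:C + 1) / 2 * w (j - 1)).
Proof. by rewrite /lax_wendroff_interior; field. Qed.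

Lemma lax_wendroff_right al ar am w j : 2 <= j ->
  lax_wendroff al ar am w j = lax_wendroff_interior ar w j.
Proof. by rewrite /lax_wendroff => ->. Qed.

Lemma lax_wendroff_left al ar am w j : j <= -1 ->
  lax_wendroff al ar am w j = lax_wendroff_interior al w j.
Proof. by move=> j1; rewrite /lax_wendroff j1 ifF//; lia. Qed.

Variant lax_wendroff_position (j : int) : Prop :=
  | AtRight of 2 <= j | AtLeft of j <= -1 | AtZero of j = 0 | AtOne of j = 1.

Lemma lax_wendroff_positionP j : lax_wendroff_position j.
Proof.
have [j2|j2] := leP 2 j; first exact: AtRight.
have [j1|j1] := leP j (-1); first exact: AtLeft.
have [->|j0] := eqVneq j 0; first exact: AtZero.
by apply: AtOne; lia.
Qed.

(** For j >= 2 the stencil sees only [psi], for j <= -1 only [phi], and each solves its own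
    recurrence there. The cells 0 and 1 carry the whole residual, linear in (c, d). *)
Lemma modes_residual al ar am z l s phi psi (c d : R[i]) j :
  char_eq al z l -> char_eq ar z s -> l != 0 -> s != 0 ->
  phi 0 = 1 -> (forall j, 1 <= j -> phi j = 0) ->
  (forall j, j <= 0 -> phi j = l * phi (j - 1)) ->
  psi 1 = 1 -> (forall j, j <= 0 -> psi j = 0) ->
  (forall j, 1 <= j -> psi (j + 1) = s * psi j) ->
  let w := (c \*o phi) \+ (d \*o psi) in
  z * w j - lax_wendroff al ar am w j =
    if j == 0 then
      - (al%:C / 2) * left_factor al am l * c + ar%:C * (1 - am%:C) / 2 * d
    else if j == 1 then
      - (al%:C * (1 + am%:C) / 2) * c - ar%:C / 2 * right_factor ar am s * d
    else 0.
Proof.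
move=> cl cs l0 s0 phi0 phiR phiL psi1 psiL psiR w.
case: (lax_wendroff_positionP j) => [j2|j1|->|->].
- rewrite lax_wendroff_right// interior_residual !ifF; [|lia..].
  rewrite /w /= !phiR; [|lia..].
  rewrite psiR; last by lia.
  have -> : psi j = s * psi (j - 1) by rewrite -psiR ?subrK//; lia.
  rewrite -(mulr0 (- d * psi (j - 1))) -[in RHS]cs; ring.
- rewrite lax_wendroff_left// interior_residual !ifF; [|lia..].
  rewrite /w /= !psiL; [|lia..].
  rewrite (phiL (j + 1)) ?addrK; last by lia.
  rewrite (phiL j); last by lia.
  rewrite -(mulr0 (- c * phi (j - 1))) -[in RHS]cl; ring.
- rewrite eqxx /lax_wendroff /w /=.
  have -> : phi (-1) = l^-1 by apply: (mulfI l0); rewrite mulfV// -phi0 (phiL 0).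
  rewrite phi0 (phiR 1)// psi1 !psiL// /left_factor.
  (* Eliminating z through the characteristic equation turns the claim into a rational identity in
     l. *)
  have -> : z = (al%:C * (al%:C - 1) / 2 * l ^+ 2 + (1 - al%:C ^+ 2) * l
     + al%:C * (al%:C + 1) / 2) / l.
    by apply: (mulIf l0); rewrite divfK// -[LHS]addr0 -[X in _ + X]cl; ring.
  by field.
- rewrite /lax_wendroff /w /=.
  have -> : psi 2 = s by have := psiR 1 isT; rewrite psi1 mulr1 => <-.
  rewrite phi0 !phiR// psi1 !psiL// /right_factor.
  have -> : z = (ar%:C * (ar%:C - 1) / 2 * s ^+ 2 + (1 - ar%:C ^+ 2) * s
     + ar%:C * (ar%:C + 1) / 2) / s.
    by apply: (mulIf s0); rewrite divfK// -[LHS]addr0 -[X in _ + X]cs; ring.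
  by field.
Qed.

(** At z = 1 the characteristic roots are 1 and (1 + a)/(a - 1). The second has modulus above 1 for
    a = al and below 1 for a = ar, so it supplies a decaying mode on each side. *)
Lemma eigenvalue_1 al ar am (q : \bar R) : (1 <= q)%E -> 0 < al < 1 -> -1 < ar < 0 ->
  is_eigenvalue q (lax_wendroff al ar am) 1.
Proof.
move=> q1; move=> /andP[al0 al1] /andP[ar1 ar0].
have al1n : al - 1 < 0 by rewrite subr_lt0.
have ar1n : ar - 1 < 0 by rewrite subr_lt0 (lt_trans ar0).
have al1p : 0 < 1 + al by rewrite addr_gt0.
have ar1p : 0 < 1 + ar by rewrite -ltrBlDl sub0r.
pose l : R[i] := ((1 + al) / (al - 1))%:C.
pose s : R[i] := ((1 + ar) / (ar - 1))%:C.
have l1 : 1 < normc l.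
  rewrite /l normc_real normrM normfV (ltr0_norm al1n) (gtr0_norm al1p).
  by rewrite ltr_pdivlMr ?oppr_gt0// mul1r opprB ltrD2l; clear q1; lra.
have s1 : normc s < 1.
  rewrite /s normc_real normrM normfV (ltr0_norm ar1n) (gtr0_norm ar1p).
  by rewrite ltr_pdivrMr ?oppr_gt0// mul1r opprB ltrD2l; clear q1; lra.
have l0 : l != 0 by apply: contraTneq l1 => ->; rewrite normc0 ltr10.
have s0 : s != 0 by rewrite /s fmorph_eq0 mulf_eq0 invr_eq0 (gt_eqF ar1p) (lt_eqF ar1n).
have alC0 : al%:C != 0 :> R[i] by rewrite fmorph_eq0 gt_eqF//.
have arC0 : ar%:C != 0 :> R[i] by rewrite fmorph_eq0 lt_eqF//.
have one : 1 = (1 : R)%:C by rewrite rmorph1.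
have alC : al%:C - 1 != 0 :> R[i] by rewrite one -rmorphB fmorph_eq0 lt_eqF//.
have arC : ar%:C - 1 != 0 :> R[i] by rewrite one -rmorphB fmorph_eq0 lt_eqF//.
have arC1 : 1 + ar%:C != 0 :> R[i] by rewrite one -rmorphD fmorph_eq0 gt_eqF//.
have lE : l = (1 + al%:C) / (al%:C - 1) by rewrite /l fmorph_div rmorphD rmorphB rmorph1.
have sE : s = (1 + ar%:C) / (ar%:C - 1) by rewrite /s fmorph_div rmorphD rmorphB rmorph1.
have cl : char_eq al 1 l by rewrite /char_eq lE; field.
have cs : char_eq ar 1 s by rewrite /char_eq sE; field.
have [phi [lphi phi0 phiR phiL]] := left_mode q1 l1.
have [psi [lpsi psi1 psiL psiR]] := right_mode q1 s1.
(* At z = 1 the factors reduce to -(1 + am) on the left and 1 - am on the right, and (c, d) spans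
   the kernel of the resulting 2 x 2 matrix. Both entries vanish only if am = 1 and am = -1. *)
pose c : R[i] := ar%:C * (1 - am%:C); pose d : R[i] := - al%:C * (1 + am%:C).
exists ((c \*o phi) \+ (d \*o psi)); split.
- by apply: lqD => //; exact: lqZ.
- move=> w0.
  have /= := congr1 (fun w => w 0) w0; rewrite phi0 psiL// mulr1 mulr0 addr0 => /eqP.
  have /= := congr1 (fun w => w 1) w0; rewrite psi1 phiR// mulr1 mulr0 add0r => /eqP.
  rewrite mulf_eq0 oppr_eq0 (negbTE alC0) mulf_eq0 (negbTE arC0)/= => h1.
  by rewrite subr_eq0 => /eqP h2; move: h1; rewrite -h2 -(natrD _ 1 1) pnatr_eq0.
apply/funext => j; apply/eqP; rewrite eq_sym -subr_eq0; apply/eqP.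
rewrite (modes_residual am c d j cl cs l0 s0 phi0 phiR phiL psi1 psiL psiR).
rewrite /left_factor /right_factor lE sE /c /d.
by case: ifP => _; [field|case: ifP => _ //; field; rewrite arC arC1].
Qed.

End eigenvalue.

(** * The resolvent *)

Section resolvent.
Variable R : realType.
Implicit Types (q : \bar R) (al ar am : R) (u v w h : int -> R[i]) (z l s : R[i]).

Lemma lax_wendroff_linear al ar am (c : R[i]) u v j :
  lax_wendroff al ar am ((c \*o u) \+ v) j =
  c * lax_wendroff al ar am u j + lax_wendroff al ar am v j.
Proof.
rewrite /lax_wendroff /lax_wendroff_interior /=.
by case: ifP => _; [|case: ifP => _; [|case: ifP => _]]; field.
Qed.

(** Each of the two residuals is a fixed linear combination of three neighbouring values of w; the
    constant adds the moduli of all six coefficients. *)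
Lemma boundary_residual_bound al ar am z : exists C : R, forall w (B : R),
  (forall j, normc (w j) <= B) ->
  normc (z * w 0 - lax_wendroff al ar am w 0) <= C * B /\
  normc (z * w 1 - lax_wendroff al ar am w 1) <= C * B.
Proof.
have lin3 (a b c x y t : R[i]) (B : R) :
    normc x <= B -> normc y <= B -> normc t <= B ->
    normc (a * x + b * y + c * t) <= (normc a + normc b + normc c) * B.
  move=> xB yB tB; rewrite !mulrDl.
  apply: (le_trans (normcD_le _ _)); apply: lerD; last first.
    by rewrite normcM; apply: ler_wpM2l => //; exact: normc_ge0.
  by apply: (le_trans (normcD_le _ _)); apply: lerD;
    rewrite normcM; apply: ler_wpM2l => //; exact: normc_ge0.
pose a0 : R[i] := - (al%:C + al%:C ^+ 2) / 2.
pose b0 : R[i] := z - 1 + al%:C * (al%:C + am%:C) / 2.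
pose c0 : R[i] := (ar%:C - ar%:C * am%:C) / 2.
pose a1 : R[i] := - (al%:C + al%:C * am%:C) / 2.
pose b1 : R[i] := z - 1 + ar%:C * (ar%:C + am%:C) / 2.
pose c1 : R[i] := (ar%:C - ar%:C ^+ 2) / 2.
exists ((normc a0 + normc b0 + normc c0) + (normc a1 + normc b1 + normc c1)) => w B wB.
have B0 : 0 <= B by apply: le_trans (wB 0); exact: normc_ge0.
split.
  rewrite (_ : _ - _ = a0 * w (-1) + b0 * w 0 + c0 * w 1); last first.
    by rewrite /lax_wendroff /= /a0 /b0 /c0; field.
  by apply: (le_trans (@lin3 _ _ _ _ _ _ B _ _ _)) => //;
    rewrite [leRHS]mulrDl lerDl mulr_ge0 ?addr_ge0 ?normc_ge0.
rewrite (_ : _ - _ = a1 * w 0 + b1 * w 1 + c1 * w 2); last first.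
  by rewrite /lax_wendroff /= /a1 /b1 /c1; field.
by apply: (le_trans (@lin3 _ _ _ _ _ _ B _ _ _)) => //;
  rewrite [leRHS]mulrDl lerDr mulr_ge0 ?addr_ge0 ?normc_ge0.
Qed.

(** The direct implication serves injectivity of z - T, the converse serves solvability. *)
Lemma cramer2 (m00 m01 m10 m11 c d r0 r1 : R[i]) : m00 * m11 - m01 * m10 != 0 ->
  (m00 * c + m01 * d = r0 /\ m10 * c + m11 * d = r1) <->
  (c = (m11 * r0 - m01 * r1) / (m00 * m11 - m01 * m10) /\
   d = (m00 * r1 - m10 * r0) / (m00 * m11 - m01 * m10)).
Proof.
move=> D; split=> -[]; first by move=> <- <-; split; field.
by move=> -> ->; split; field.
Qed.

Variables (q : \bar R) (al ar am : R) (z : R[i]).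
Hypotheses (q1 : (1 <= q)%E) (al01 : 0 < al < 1) (ar01 : -1 < ar < 0).
Hypotheses (z1 : 1 <= normc z) (zn1 : z <> 1).
Hypothesis Delta0 : Lopatinskii al ar am z <> 0.

Let T := lax_wendroff al ar am.
Let l := kappa_l al z.
Let r := kappa_r al z.
Let s := kappa_r ar z.
Let t := kappa_l ar z.

Let al0 : al != 0. Proof. by case/andP: al01 => ? _; rewrite gt_eqF. Qed.
Let ar0 : ar != 0. Proof. by case/andP: ar01 => _ ?; rewrite lt_eqF. Qed.
Let al11 : -1 < al < 1.
Proof. by case/andP: al01 => a0 ->; rewrite andbT (lt_trans _ a0)// ltrN10. Qed.
Let ar11 : -1 < ar < 1.
Proof. by case/andP: ar01 => -> a0; rewrite (lt_trans a0)// ltr01. Qed.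

Let M00 : R[i] := - (al%:C / 2) * left_factor al am l.
Let M01 : R[i] := ar%:C * (1 - am%:C) / 2.
Let M10 : R[i] := - (al%:C * (1 + am%:C) / 2).
Let M11 : R[i] := - (ar%:C / 2) * right_factor ar am s.

Let det_neq0 : M00 * M11 - M01 * M10 != 0.
Proof.
have -> : M00 * M11 - M01 * M10 = al%:C * ar%:C / 4 * Lopatinskii al ar am z.
  rewrite /Lopatinskii -/(left_factor al am l) -/(right_factor ar am s).
  by rewrite /M00 /M01 /M10 /M11; field.
by rewrite !mulf_neq0 ?fmorph_eq0//; exact/eqP.
Qed.

Let interior_left w j : z * w j - lax_wendroff_interior al w j =
  - (al%:C * (al%:C - 1) / 2 * w (j + 1) - al%:C * (al%:C - 1) / 2 * (l + r) * w j
     + al%:C * (al%:C - 1) / 2 * (l * r) * w (j - 1)).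
Proof.
have [_ _ prod sum] := kappa_spec al0 al11 (sqrt_lt_normc al0 z1).
rewrite interior_residual [l + r]addrC [l * r]mulrC prod sum; ring.
Qed.

Let interior_right w j : z * w j - lax_wendroff_interior ar w j =
  - (ar%:C * (ar%:C - 1) / 2 * w (j + 1) - ar%:C * (ar%:C - 1) / 2 * (t + s) * w j
     + ar%:C * (ar%:C - 1) / 2 * (t * s) * w (j - 1)).
Proof.
have [_ _ prod sum] := kappa_spec ar0 ar11 (sqrt_lt_normc ar0 z1).
rewrite interior_residual [t + s]addrC [t * s]mulrC prod sum; ring.
Qed.

Lemma modes : exists phi psi, [/\ lq q phi, lq q psi &
  [/\ phi 0 = 1, forall j, 1 <= j -> phi j = 0,
      forall j, j <= 0 -> phi j = l * phi (j - 1) & l != 0] /\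
  [/\ psi 1 = 1, forall j, j <= 0 -> psi j = 0 &
      forall j, 1 <= j -> psi (j + 1) = s * psi j] /\
  forall c d j, z * (c * phi j + d * psi j) - T ((c \*o phi) \+ (d \*o psi)) j =
    if j == 0 then M00 * c + M01 * d else if j == 1 then M10 * c + M11 * d else 0].
Proof.
have /andP[_ l1] := kappa_modulus al0 al11 z1 zn1.
have /andP[s1 _] := kappa_modulus ar0 ar11 z1 zn1.
have [cl _ _ _] := kappa_spec al0 al11 (sqrt_lt_normc al0 z1).
have [cs /andP[s0 _] _ _] := kappa_spec ar0 ar11 (sqrt_lt_normc ar0 z1).
have [phi [lphi phi0 phiR phiL]] := left_mode q1 l1.
have [psi [lpsi psi1 psiL psiR]] := right_mode q1 s1.
have l0 : l != 0 by apply: contraTneq l1 => h; rewrite -/l h normc0 ltr10.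
have s0' : s != 0 by apply: contraTneq s0 => h; rewrite -/s h normc0 ltxx.
exists phi, psi; split => //; split; first by split.
split; first by split.
move=> c d j.
have /= := modes_residual am c d j ((cl l).2 (or_intror erefl))
  ((cs s).2 (or_introl erefl)) l0 s0' phi0 phiR phiL psi1 psiL psiR.
by rewrite -/T => ->; case: ifP => // _; case: ifP => // _; rewrite /M10 /M11; ring.
Qed.

(** Boundedness leaves only the decaying mode on each half-line, so w is the combination of [phi]
    and [psi] with coefficients w(0) and w(1). Its residual at cells 0 and 1 is a homogeneous system
    with nonzero determinant. *)
Lemma lax_wendroff_injective w : lq q w -> (forall j, z * w j - T w j = 0) ->
  w = (fun=> 0).
Proof.
move=> lw wE; have [phi [psi [lphi lpsi [[phi0 phiR phiL l0] [[psi1 psiL psiR] res]]]]] := modes.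
have /andP[r1 _] := kappa_modulus al0 al11 z1 zn1.
have /andP[_ t1] := kappa_modulus ar0 ar11 z1 zn1.
have wb := lq_bounded q1 lw.
have wL : forall j, j <= 0 -> w j = l * w (j - 1).
  apply: (second_order_kernel_left (leading_coef_neq0 al0 al11) r1 wb) => j j1.
  by apply: oppr_inj; rewrite -interior_left oppr0 -(lax_wendroff_left _ ar am)// wE.
have wR : forall j, 1 <= j -> w (j + 1) = s * w j.
  apply: (second_order_kernel_right (leading_coef_neq0 ar0 ar11) t1 wb) => j j1.
  by apply: oppr_inj; rewrite -interior_right oppr0 -(lax_wendroff_right al _ am)// wE.
have wmodes : w = (w 0 \*o phi) \+ (w 1 \*o psi).
  have left n : w (- n%:Z) = w 0 * phi (- n%:Z).
    elim: n => [|n IH]; first by rewrite oppr0 phi0 mulr1.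
    apply: (mulfI l0); rewrite mulrCA.
    have -> : - n.+1%:Z = - n%:Z - 1 by clear; lia.
    by rewrite -wL -?phiL//; clear; lia.
  have right n : w (1 + n%:Z) = w 1 * psi (1 + n%:Z).
    elim: n => [|n IH]; first by rewrite addr0 psi1 mulr1.
    have -> : 1 + n.+1%:Z = 1 + n%:Z + 1 by clear; lia.
    by rewrite wR ?psiR ?IH; [ring|clear; lia..].
  apply/funext => j /=; have [j0|j0] := leP j 0.
    have -> : j = - `|j|%N%:Z by clear -j0; lia.
    by rewrite left psiL ?mulr0 ?addr0//; clear; lia.
  have -> : j = 1 + `|j - 1|%N%:Z by clear -j0; lia.
  by rewrite right phiR ?mulr0 ?add0r//; clear; lia.
have E j : z * (w 0 * phi j + w 1 * psi j) - T ((w 0 \*o phi) \+ (w 1 \*o psi)) j = 0.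
  by rewrite -wmodes -[X in z * X]/(((w 0 \*o phi) \+ (w 1 \*o psi)) j) -wmodes wE.
have E0 := E 0; have E1 := E 1; rewrite !res /= in E0 E1.
have [w00 w10] := (cramer2 _ _ _ _ det_neq0).1 (conj E0 E1).
rewrite wmodes w00 w10; apply/funext => j /=.
by rewrite !mulr0 !subr0 !mul0r addr0.
Qed.

Lemma lax_wendroff_solve : exists K : R, forall h, lq q h ->
  exists w, (forall j, z * w j - T w j = h j) /\
    (lq_norm q w <= K%:E * lq_norm q h)%E.
Proof.
have [phi [psi [lphi lpsi [[phi0 phiR phiL l0] [[psi1 psiL psiR] res]]]]] := modes.
have /andP[r1 l1] := kappa_modulus al0 al11 z1 zn1.
have /andP[s1 t1] := kappa_modulus ar0 ar11 z1 zn1.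
have [KL solL] := second_order_solve q1 (leading_coef_neq0 al0 al11) r1 l1.
have [KR solR] := second_order_solve q1 (leading_coef_neq0 ar0 ar11) s1 t1.
have [C resC] := boundary_residual_bound al ar am z.
pose D := M00 * M11 - M01 * M10.
(* [Q] bounds the defects left at cells 0 and 1 relative to the norm of h; [nc] and [nd] carry that
   bound through Cramer's formulas. *)
pose Q : R := 1 + C * (KL + KR).
pose nc := (normc M11 + normc M01) / normc D * Q.
pose nd := (normc M00 + normc M10) / normc D * Q.
exists (KL + KR + (nc * fine (lq_norm q phi) + nd * fine (lq_norm q psi))) => h lh.
set H := fine (lq_norm q h).
have HE : lq_norm q h = H%:E := lq_normEfine lh.
(* The factored recurrence is minus (z - T) in the interior, so it is solved with source -h. *)
have lNh : lq q (-1 \*o h) by exact: lqZ.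
have Nh : lq_norm q (-1 \*o h) = H%:E.
  have N1 u : (lq_norm q (-1 \*o u) <= lq_norm q u)%E.
    by apply: (le_trans (lq_normZ _ _ q1)); rewrite normcNr normc1 mul1e.
  apply/le_anti; rewrite -HE N1/=; apply: le_trans (N1 (-1 \*o h)).
  by apply: lq_norm_mono => // j /=; rewrite !mulN1r opprK.
have [wl [wlE wln]] := solL _ lNh.
have [wr [wrE wrn]] := solR _ lNh.
(* With the cut between 0 and 1, the stencil at j <= -1 meets only [wl] and at j >= 2 only [wr]. *)
pose w0 j := if j <= 0 then wl j else wr j.
have w0n : (lq_norm q w0 <= ((KL + KR) * H)%:E)%E.
  have -> : w0 = (fun j => if j <= 0 then wl j else 0) \+ (fun j => if j <= 0 then 0 else wr j).
    by apply/funext => j; rewrite /w0 /=; case: ifP; rewrite ?addr0 ?add0r.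
  apply: (le_trans (lq_normD _ _ q1)); rewrite mulrDl EFinD.
  apply: leeD; rewrite EFinM -Nh; [apply: le_trans wln|apply: le_trans wrn];
    by apply: lq_norm_mono => // j; case: ifP => //; rewrite normc0 normc_ge0.
have lw0 : lq q w0 by exact: lq_dominated w0n.
have w0b j : normc (w0 j) <= (KL + KR) * H.
  by rewrite -lee_fin; apply: le_trans w0n; exact: lq_norm_point.
have [b0 b1] := resC _ _ w0b.
pose r0 := h 0 - (z * w0 0 - T w0 0).
pose r1' := h 1 - (z * w0 1 - T w0 1).
have rb (x y : R[i]) : normc x <= H -> normc y <= C * ((KL + KR) * H) ->
    normc (x - y) <= Q * H.
  move=> xH yH; apply: (le_trans (normcD_le _ _)); rewrite normcNr /Q mulrDl mul1r -mulrA.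
  exact: lerD.
have r0b : normc r0 <= Q * H by apply: rb => //; exact: lq_bounded.
have r1b : normc r1' <= Q * H by apply: rb => //; exact: lq_bounded.
pose c := (M11 * r0 - M01 * r1') / D.
pose d := (M00 * r1' - M10 * r0) / D.
have [cd0 cd1] := (cramer2 c d r0 r1' det_neq0).2 (conj erefl erefl).
have lin2 (a b x y : R[i]) : normc x <= Q * H -> normc y <= Q * H ->
    normc ((a * x - b * y) / D) <= (normc a + normc b) / normc D * Q * H.
  move=> xQ yQ; rewrite normcM normcV -!mulrA [_^-1 * _]mulrC !mulrA.
  apply: ler_wpM2r; first by rewrite invr_ge0 normc_ge0.
  apply: (le_trans (normcD_le _ _)); rewrite normcNr !normcM -mulrA mulrDl.
  by apply: lerD; apply: ler_wpM2l => //; exact: normc_ge0.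
have cb : normc c <= nc * H by exact: lin2.
have db : normc d <= nd * H by exact: lin2.
exists ((1 \*o w0) \+ ((c \*o phi) \+ (d \*o psi))); split.
  move=> j.
  rewrite /T lax_wendroff_linear -/T mul1r.
  have -> : forall x y a b : R[i], z * (x + y) - (a + b) = (z * x - a) + (z * y - b).
    by move=> *; ring.
  rewrite res (_ : (1 \*o w0) j = w0 j); last exact: mul1r.
  case: (lax_wendroff_positionP j) => [j2|j1|->|->].
  - rewrite !ifF ?addr0; [|clear -j2; lia..].
    rewrite /T lax_wendroff_right// interior_right /w0 !ifF; [|clear -j2; lia..].
    by rewrite wrE /= mulN1r opprK.
  - rewrite !ifF ?addr0; [|clear -j1; lia..].
    rewrite /T lax_wendroff_left// interior_left /w0 !ifT; [|clear -j1; lia..].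
    by rewrite wlE /= mulN1r opprK.
  - by rewrite eqxx cd0 /r0 addrC subrK.
  - by rewrite /= cd1 /r1' addrC subrK.
apply: (le_trans (lq_normD _ _ q1)).
rewrite HE -EFinM mulrDl EFinD; apply: leeD.
  by apply: (le_trans (lq_normZ _ _ q1)); rewrite normc1 mul1e.
apply: (le_trans (lq_normD _ _ q1)); rewrite mulrDl EFinD; apply: leeD.
  apply: (le_trans (lq_normZ _ _ q1)); rewrite (lq_normEfine lphi) -EFinM lee_fin mulrAC.
  by apply: ler_wpM2r => //; rewrite -lee_fin -lq_normEfine// lq_norm_ge0.
apply: (le_trans (lq_normZ _ _ q1)); rewrite (lq_normEfine lpsi) -EFinM lee_fin mulrAC.
by apply: ler_wpM2r => //; rewrite -lee_fin -lq_normEfine// lq_norm_ge0.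
Qed.

(** The inverse picks the unique l^q solution. Uniqueness gives its linearity, transfers the norm
    bound to it and makes it a left inverse; being a right inverse is its defining property. *)
Lemma lax_wendroff_resolvent : resolvent_set q T z.
Proof.
have [K solve] := lax_wendroff_solve.
pose sols h := [set w | lq q w /\ forall j, z * w j - T w j = h j].
have uniq h w w' : sols h w -> sols h w' -> w = w'.
  move=> [lw wE] [lw' wE'].
  have : (-1 \*o w) \+ w' = (fun=> 0).
    apply: lax_wendroff_injective; first by apply: lqD => //; exact: lqZ.
    move=> j; rewrite /T lax_wendroff_linear -/T /=.
    rewrite (_ : _ - _ = (z * w' j - T w' j) - (z * w j - T w j)); last by ring.
    by rewrite wE wE' subrr.
  move=> e; apply/funext => j; have /= := congr1 (@^~ j) e.
  by rewrite mulN1r addrC => /eqP; rewrite subr_eq0 => /eqP.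
have ex h : lq q h -> exists2 w, sols h w & (lq_norm q w <= K%:E * lq_norm q h)%E.
  move=> lh; have [w [wE wn]] := solve h lh; exists w => //; split => //.
  apply: (@lq_dominated _ _ _ (K * fine (lq_norm q h))).
  by rewrite EFinM -lq_normEfine.
pose S h := xget (fun=> 0) (sols h).
have SE h w : sols h w -> S h = w.
  by move=> hw; apply: xget_unique => // w' hw'; exact: uniq hw' hw.
have SP h : lq q h -> sols h (S h).
  by move=> /ex[w hw _]; rewrite (SE _ _ hw).
exists S; split; first split.
- move=> c u v lu lv; apply: SE.
  have [lSu Su] := SP _ lu; have [lSv Sv] := SP _ lv.
  split; first by apply: lqD => //; exact: lqZ.
  move=> j; rewrite /T lax_wendroff_linear -/T /= -Su -Sv; ring.
- exists K => w lw; have [w' hw'] := ex _ lw.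
  by rewrite (SE _ _ hw').
move=> w lw; split; first exact: SE.
by have [_ Sw] := SP _ lw; apply/funext => j; exact: Sw.
Qed.

End resolvent.

Theorem theorem2p3 (R : realType) (f : R -> R) (ul ur lambda al ar am : R)
  (f_smooth : smooth f)
  (lambda_gt0 : 0 < lambda)
  (alE : al = lambda * derive1 f ul)
  (arE : ar = lambda * derive1 f ur)
  (amE : am = lambda * derive1 f ((ul + ur) / 2))
  (Rankine_Hugoniot : f ul = f ur)
  (entropy : derive1 f ur < 0 < derive1 f ul)
  (CFL : Num.max al `|ar| < 1) :
  [/\ exists U : set R[i]^o,
        [/\ [set z | 1 <= normc z] `<=` U,
            U `<=` Lopatinskii_domain al ar,
            forall z, U z -> char_split al z /\ char_split ar z
          & holomorphic_on U (Lopatinskii al ar am)],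
      forall q : \bar R, (1 <= q)%E ->
        is_eigenvalue q (lax_wendroff al ar am) 1
    & derive1 (Lopatinskii al ar am) 1 <> 0 ->
      (forall z : R[i], 1 <= normc z -> z <> 1 ->
         Lopatinskii al ar am z <> 0) ->
      forall q : \bar R, (1 <= q)%E ->
      forall z : R[i], 1 <= normc z -> z <> 1 ->
        ~ spectrum q (lax_wendroff al ar am) z].
Proof.
have /andP[fur ful] := entropy.
have al0 : 0 < al by rewrite alE mulr_gt0.
have ar0 : ar < 0 by rewrite arE pmulr_rlt0.
move: CFL; rewrite gt_max ltr_norml => /andP[al1 /andP[ar1 _]].
have al01 : 0 < al < 1 by rewrite al0.
have ar01 : -1 < ar < 0 by rewrite ar1.
have al11 : -1 < al < 1 by rewrite al1 andbT (lt_trans _ al0)// ltrN10.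
have ar11 : -1 < ar < 1 by rewrite ar1 (lt_trans ar0)// ltr01.
have alN0 : al != 0 by rewrite gt_eqF.
have arN0 : ar != 0 by rewrite lt_eqF.
have split a z : a != 0 -> -1 < a < 1 -> Num.sqrt (1 - a ^+ 2) < normc z ->
    char_split a z.
  move=> a0 a11 dz; have [kP mod _ _] := kappa_spec a0 a11 dz.
  by exists (kappa_r a z), (kappa_l a z).
split.
(* The domain itself serves as the neighbourhood: it is open, and it contains |z| >= 1 because both
   coefficients are nonzero. *)
- exists (Lopatinskii_domain al ar); split.
  + by move=> z /= z1; rewrite /Lopatinskii_domain/= gt_max !sqrt_lt_normc.
  + exact: subset_refl.
  + move=> z; rewrite /Lopatinskii_domain/= gt_max => /andP[dl dr].
    by split; exact: split.
  + split; first exact: open_Lopatinskii_domain.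
    by move=> z dz; exact: derivable_Lopatinskii.
- by move=> q q1; exact: eigenvalue_1.
- move=> _ Delta0 q q1 z z1 zn1; apply.
  by apply: lax_wendroff_resolvent => //; exact: Delta0.
Qed.
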